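(* Suppose that: each gradient $\nabla f(\cdot,i)$, $i\in[n]$, is Lipschitz continuous on $\mathrm{dom}(\varphi)$ with modulus $\mathsf{L}>0$; $\varphi$ is $\rho$-weakly convex ($\rho>0$), lower semicontinuous and proper; and there are $f_{\mathrm{lb}},\varphi_{\mathrm{lb}}\in\mathbb{R}$ with $f(w,i)\ge f_{\mathrm{lb}}$ and $\varphi(w)\ge\varphi_{\mathrm{lb}}$ for all $w\in\mathrm{dom}(\varphi)$, $i\in[n]$. Let $\{w^k\}_k,\{z^k\}_k$ be generated by norm-PRR (with an arbitrary sequence of permutations) with $\lambda\in(0,\frac1{4\rho})$ and step sizes $0<\alpha_k\le\frac{\bar\alpha}{n}$ satisfying $$\sum_{k=1}^\infty\alpha_k=\infty\quad\text{and}\quad\sum_{k=1}^\infty\alpha_k\Big[\sum_{i=k}^\infty\alpha_i^3\Big]^\xi<\infty\quad\text{for some }\xi\in(0,1).$$ Assume that $\{w^k\}_k$ is bounded and that $\psi$ has the Kurdyka-{\L}ojasiewicz (KL) property at every accumulation point of $\{w^k\}_k$. Then $$\sum_{k=1}^\infty\alpha_k\cdot\mathrm{dist}(0,\partial\psi(w^k))<\infty\quad\text{and}\quad\sum_{k=1}^\infty\|w^{k+1}-w^k\|<\infty,$$ and the whole sequence $\{w^k\}_k$ converges to some stationary point $w^*$ of $\psi$, i.e., $0\in\partial\psi(w^* )$.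
   Context: Setting: $d,n\in\mathbb{N}$, $[n]=\{1,\dots,n\}$; $f(\cdot,i):\mathbb{R}^d\to\mathbb{R}$ are differentiable; $f(w)=\frac1n\sum_{i=1}^n f(w,i)$; $\varphi:\mathbb{R}^d\to(-\infty,\infty]$; $\psi=f+\varphi$. $\|\cdot\|$ is the Euclidean norm. $\varphi$ is $\rho$-weakly convex if $\varphi+\frac{\rho}{2}\|\cdot\|^2$ is convex. $\partial$ denotes the Fr\'echet (regular) subdifferential, $\partial h(x)=\{g: h(y)\ge h(x)+\langle g,y-x\rangle+o(\|y-x\|)\text{ as }y\to x\}$; here $\partial\psi=\nabla f+\partial\varphi$. $\mathrm{dist}(0,\emptyset)=+\infty$. KL property: $\psi$ has the KL property at $\bar w\in\mathrm{dom}(\psi)$ if there exist $\theta\in[0,1)$, $c>0$, $\eta\in(0,\infty]$ and a neighborhood $U$ of $\bar w$ such that $|\psi(w)-\psi(\bar w)|^\theta\le c\cdot\mathrm{dist}(0,\partial\psi(w))$ for all $w\in U$ with $0<|\psi(w)-\psi(\bar w)|<\eta$. For $\lambda\in(0,\rho^{-1})$: $\mathrm{prox}_{\lambda\varphi}(w)=\mathrm{argmin}_y\,\varphi(y)+\frac1{2\lambda}\|w-y\|^2$. Algorithm norm-PRR: given an initial point $z^1\in\mathbb{R}^d$, $w^1=\mathrm{prox}_{\lambda\varphi}(z^1)$, step sizes $\alpha_k>0$ and $\lambda>0$; for $k=1,2,\dots$: choose a permutation $\pi^k=(\pi^k_1,\dots,\pi^k_n)$ of $[n]$; set $z^k_1=z^k$,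 $w^k_1=w^k$; for $i=1,\dots,n$ set $z^k_{i+1}=z^k_i-\alpha_k(\nabla f(w^k_i,\pi^k_i)+\frac1\lambda(z^k_i-w^k_i))$ and $w^k_{i+1}=\mathrm{prox}_{\lambda\varphi}(z^k_{i+1})$; set $z^{k+1}=z^k_{n+1}$, $w^{k+1}=w^k_{n+1}$. Constants: $\mathsf{C}=4\left[\frac{3\mathsf{L}+2\lambda^{-1}-\rho}{1-\lambda\rho}\right]^2$, $\tau=\frac{1-4\lambda\rho}{2(1-2\lambda\rho+\lambda^2\mathsf{L}^2)}$, $\bar\alpha=\max\{\sqrt{2\mathsf{C}},\,10\mathsf{L},\,4\mathsf{C}\lambda\tau^{-1}\}^{-1}$. *)

(* Defs.v *)
From HB Require Import structures.
From mathcomp Require Import all_boot all_order all_algebra all_fingroup.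
From mathcomp Require Import all_classical all_reals all_analysis.

Set Implicit Arguments.
Unset Strict Implicit.
Unset Printing Implicit Defensive.

Import Order.TTheory GRing.Theory Num.Theory.
Import numFieldNormedType.Exports.

Local Open Scope classical_set_scope.
Local Open Scope ring_scope.

Section Euclidean.
Context {R : realType} {d : nat}.
Implicit Types x y : 'rV[R]_d.

Definition dotv x y : R := \sum_(j < d) x 0 j * y 0 j.

(* The library norm `|x| on 'rV[R]_d is the sup norm; it induces the same
   topology, boundedness and differentiability as the Euclidean norm, which is
   the one used in all quantitative expressions below. *)
Definition enorm x : R := Num.sqrt (dotv x x).

(* To be used only where h is differentiable. *)
Definition grad (h : 'rV[R]_d -> R) x : 'rV[R]_d :=
  \row_(j < d) 'D_(delta_mx 0 j) h x.

End Euclidean.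

Section VariationalAnalysis.
Context {R : realType} {d : nat}.
Implicit Types (h : 'rV[R]_d -> \bar R) (x y z g : 'rV[R]_d).
Local Open Scope ereal_scope.

Definition edom h : set 'rV[R]_d := [set x | h x < +oo].

Definition eproper h : Prop := (forall x, h x != -oo) /\ edom h !=set0.

(* For h without the value -oo; since 0 * +oo = 0, the cases t = 0 and t = 1
   are harmless. *)
Definition econvex h : Prop :=
  forall x y (t : R), (0 <= t <= 1)%R ->
    h (t *: x + (1 - t) *: y)%R <= t%:E * h x + (1 - t)%:E * h y.

Definition weakly_convex (rho : R) h : Prop :=
  econvex (fun x => h x + (rho / 2 * enorm x ^+ 2)%:E).

Definition argmin h : set 'rV[R]_d := [set y | forall y', h y <= h y'].

(* prox is set-valued here: "w = prox z" is rendered as membership in the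
   argmin, which is a singleton for h proper, lsc, rho-weakly convex and
   0 < lambda < 1 / rho. *)
Definition prox (lambda : R) h z : set 'rV[R]_d :=
  argmin (fun y => h y + ((2 * lambda)^-1 * enorm (z - y) ^+ 2)%:E).

(* Frechet subdifferential, empty outside the domain of h. *)
Definition subdiff h x : set 'rV[R]_d :=
  [set g | h x \is a fin_num /\
    forall e : R, (0 < e)%R -> \forall y \near x,
      h x + (dotv g (y - x))%:E - (e * enorm (y - x))%:E <= h y].

(* The distance from 0 to S; it is +oo when S is empty. *)
Definition dist0 (S : set 'rV[R]_d) : \bar R :=
  ereal_inf [set (enorm g)%:E | g in S].

Definition KL_property h (wbar : 'rV[R]_d) : Prop :=
  wbar \in edom h /\
  exists (theta c : R) (eta : \bar R) (U : set 'rV[R]_d),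
    [/\ (0 <= theta < 1)%R, (0 < c)%R, 0 < eta, nbhs wbar U &
        forall w, U w -> 0 < `|h w - h wbar| < eta ->
          `|h w - h wbar| `^ theta <= c%:E * dist0 (subdiff h w)].

End VariationalAnalysis.

Section NormPRR.
Context {R : realType} {d n : nat}.
Implicit Types (f : 'I_n -> 'rV[R]_d -> R) (phi : 'rV[R]_d -> \bar R).

Definition favg f (w : 'rV[R]_d) : R := n%:R^-1 * \sum_(i < n) f i w.

Definition psi_of f phi (w : 'rV[R]_d) : \bar R := ((favg f w)%:E + phi w)%E.

(* Outer iterations, components and inner steps are all numbered from 0:
   z k, w k, alpha k, sigma k stand for z^(k+1), w^(k+1), alpha_(k+1), pi^(k+1),
   and zi i, wi i for z^(k+1)_(i+1), w^(k+1)_(i+1). *)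
Definition norm_PRR f phi (lambda : R) (alpha : nat -> R)
    (sigma : nat -> 'S_n) (z w : nat -> 'rV[R]_d) : Prop :=
  w 0%N \in prox lambda phi (z 0%N) /\
  forall k, exists zi wi : nat -> 'rV[R]_d,
    [/\ zi 0%N = z k /\ wi 0%N = w k,
        forall i : 'I_n,
          zi i.+1 = zi i - alpha k *: (grad (f (sigma k i)) (wi i)
                                       + lambda^-1 *: (zi i - wi i)) /\
          wi i.+1 \in prox lambda phi (zi i.+1)
      & z k.+1 = zi n /\ w k.+1 = wi n].

End NormPRR.

Section Constants.
Context {R : realType}.
Variables L lambda rho : R.

Definition Cconst : R :=
  4 * ((3 * L + 2 * lambda^-1 - rho) / (1 - lambda * rho)) ^+ 2.

Definition tau : R :=
  (1 - 4 * lambda * rho) / (2 * (1 - 2 * lambda * rho + lambda ^+ 2 * L ^+ 2)).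

Definition alpha_bar : R :=
  (Num.max (Num.max (Num.sqrt (2 * Cconst)) (10 * L))
           (4 * Cconst * lambda * tau^-1))^-1.

End Constants.

(* Main.v *)
(* The error of one sweep against the exact step z - a F(z), where a = n alpha_k,
   v = (z - prox z)/lambda and F(z) = grad f(prox z) + v is the normal map, is
   O(a^2 (|F| + 1)) because the bounded iterates have bounded component gradients.
   Weak convexity makes v a global subgradient of phi at prox z up to the quadratic
   rho/2 |. - prox z|^2, so F(z) is a Frechet subgradient of psi and the merit function
   psi + tau lambda/2 |F|^2 satisfies, for tau small and k large,
     H_(k+1) <= H_k - tau/8 a_k |F_k|^2 - |w^(k+1) - w^k|^2 / (4 a_k) + O(a_k^3).
   Only large k matter, since alpha_k -> 0 by sum alpha_k^3 < oo.  Adding the tail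
   u_k of the cubic errors gives a decreasing sequence delta_k -> 0; the KL inequality
   bounds delta_k^theta by a multiple of |F_k| + u_k^theta, and concavity of
   s^(1-theta) makes a_k |F_k| and |w^(k+1) - w^k| summable. *)

Require Import Defs.
From HB Require Import structures.
From mathcomp Require Import all_boot all_order all_algebra all_fingroup.
From mathcomp Require Import all_classical all_reals all_analysis.
From mathcomp Require Import ring lra.

Set Implicit Arguments.
Unset Strict Implicit.
Unset Printing Implicit Defensive.

Import Order.TTheory GRing.Theory Num.Theory.
Import numFieldNormedType.Exports.

Local Open Scope classical_set_scope.
Local Open Scope ring_scope.

(** * Euclidean inner product and norm *)

(** The algorithm moves [z] while [psi] is evaluated at [w], and the normal map F links the two:
    paired with the change of [w] it makes [psi] decrease, by strong monotonicity of the prox;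
    paired with the change of [z] it yields the term -a|F|^2 through the square in the merit
    function. Divergent step sizes with summable a_k |F_k|^2 would only give liminf |F_k| = 0. The
    descent holds for every small weight tau, however, and comparing two weights makes |F_k|^2
    itself converge, necessarily to 0; then psi(w^k) converges as well. At an accumulation point,
    lower semicontinuity gives only one inequality between [psi] and this limit. The other comes
    from testing the bounded weak subgradients at the accumulation point. Only then do all local KL
    inequalities refer to the same value and can be merged. Since psi(w^k) is eventually within 1 of
    its limit, the KL exponent may be raised: to at least 1/2, so that |F|^(2 theta) <= |F| when |F|
    <= 1, and above xi, so that the assumed tail condition controls the sum of a_k u_k^theta. *)

Section EuclideanTheory.
Context {R : realType} {d : nat}.
Implicit Types (x y z g : 'rV[R]_d) (s t : R).

Lemma dotvC x y : dotv x y = dotv y x.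
Proof. by apply: eq_bigr => j _; rewrite mulrC. Qed.

Lemma dotvDl x y z : dotv (x + y) z = dotv x z + dotv y z.
Proof. by rewrite /dotv -big_split; apply: eq_bigr => j _; rewrite mxE mulrDl. Qed.

Lemma dotvZl s x y : dotv (s *: x) y = s * dotv x y.
Proof. by rewrite /dotv big_distrr; apply: eq_bigr => j _; rewrite mxE /= mulrA. Qed.

Lemma dotvNl x y : dotv (- x) y = - dotv x y.
Proof. by rewrite -scaleN1r dotvZl mulN1r. Qed.

Lemma dotvDr x y z : dotv x (y + z) = dotv x y + dotv x z.
Proof. by rewrite dotvC dotvDl !(dotvC x). Qed.

Lemma dotvZr s x y : dotv x (s *: y) = s * dotv x y.
Proof. by rewrite dotvC dotvZl dotvC. Qed.

Lemma dotvNr x y : dotv x (- y) = - dotv x y.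
Proof. by rewrite dotvC dotvNl dotvC. Qed.

Definition dotvE := (dotvDl, dotvDr, dotvNl, dotvNr, dotvZl, dotvZr).

Lemma dotvv_ge0 x : 0 <= dotv x x.
Proof. by apply: sumr_ge0 => j _; rewrite -expr2 sqr_ge0. Qed.

Lemma enorm_ge0 x : 0 <= enorm x.
Proof. exact: sqrtr_ge0. Qed.

Lemma sqr_enorm x : enorm x ^+ 2 = dotv x x.
Proof. by rewrite sqr_sqrtr// dotvv_ge0. Qed.

Lemma enormN x : enorm (- x) = enorm x.
Proof. by rewrite /enorm !dotvE opprK. Qed.

Lemma enormB x y : enorm (x - y) = enorm (y - x).
Proof. by rewrite -enormN opprB. Qed.

Lemma enormZ t x : enorm (t *: x) = `|t| * enorm x.
Proof.
by rewrite /enorm !dotvE mulrA -expr2 sqrtrM ?sqr_ge0// sqrtr_sqr.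
Qed.

Lemma enorm0 : enorm (0 : 'rV[R]_d) = 0.
Proof. by rewrite -(scale0r 0) enormZ normr0 mul0r. Qed.

(** Cauchy-Schwarz, from the nonnegative square of |y|^2 x - <x,y> y, which equals |y|^2 (|x|^2
    |y|^2 - <x,y>^2); the case |y| = 0 is separate because nothing can be cancelled there. *)
Lemma dotv_le_enorm x y : dotv x y <= enorm x * enorm y.
Proof.
have xx := dotvv_ge0 x; have yy := dotvv_ge0 y.
have key : dotv x y ^+ 2 <= dotv x x * dotv y y.
  have := dotvv_ge0 (dotv y y *: x - dotv x y *: y).
  rewrite !dotvE (dotvC y x); set a := dotv x x; set b := dotv y y.
  set c := dotv x y => h.
  have {}h : 0 <= b * (a * b - c ^+ 2) by lra.
  have [b0|b0] := eqVneq b 0; last first.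
    have bp : 0 < b by rewrite lt_def b0.
    by move: h; rewrite pmulr_rge0// subr_ge0.
  have : dotv x y = 0; last by rewrite -/c => ->; rewrite b0 mulr0 expr0n.
  move/eqP: b0; rewrite psumr_eq0; last by move=> j _; rewrite -expr2 sqr_ge0.
  move=> /allP y0; apply: big1 => j _.
  have /implyP/(_ isT) := y0 j (mem_index_enum _).
  by rewrite -expr2 sqrf_eq0 => /eqP ->; rewrite mulr0.
apply: le_trans (ler_norm _) _.
by rewrite /enorm -sqrtrM// -sqrtr_sqr ler_wsqrtr.
Qed.

Lemma ler_enormD x y : enorm (x + y) <= enorm x + enorm y.
Proof.
rewrite -(@ler_pXn2r _ 2)// ?nnegrE ?addr_ge0 ?enorm_ge0//.
rewrite sqr_enorm !dotvE (dotvC y x) sqrrD !sqr_enorm.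
have := dotv_le_enorm x y; lra.
Qed.

Lemma ler_enormB_trans y x z : enorm (x - z) <= enorm (x - y) + enorm (y - z).
Proof. by rewrite -{1}(subrK y x) -addrA ler_enormD. Qed.

Lemma ler_enorm_sum (I : Type) (r : seq I) (P : pred I) (F : I -> 'rV[R]_d) :
  enorm (\sum_(i <- r | P i) F i) <= \sum_(i <- r | P i) enorm (F i).
Proof.
elim/big_rec2: _ => [|i a b _ IH]; first by rewrite enorm0.
by apply: le_trans (ler_enormD _ _) _; rewrite lerD2l.
Qed.

Lemma normr_le_enorm x : `|x| <= enorm x.
Proof.
rewrite [`|x|]mx_normrE; apply/bigmax_leP; split=> [|[i j] _]; first exact: enorm_ge0.
rewrite /= ord1 -sqrtr_sqr; apply: ler_wsqrtr.
rewrite /dotv (bigD1 j)//= -expr2 lerDl; apply: sumr_ge0 => k _.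
by rewrite -expr2 sqr_ge0.
Qed.

(** The crude factor [d.+1] is positive even for [d = 0], so it can be divided by when
    neighbourhoods are compared. *)
Lemma enorm_le_normr x : enorm x <= d.+1%:R * `|x|.
Proof.
rewrite -(ger0_norm (mulr_ge0 (ler0n _ _) (normr_ge0 x))) -sqrtr_sqr.
apply: ler_wsqrtr.
have le1 j : x 0 j * x 0 j <= `|x| ^+ 2.
  rewrite -expr2 -real_normK ?num_real// ler_sqr ?nnegrE//.
  by rewrite [leRHS]mx_normrE; apply: (le_bigmax _ (fun ij => `|x ij.1 ij.2|) (0, j)).
apply: (@le_trans _ _ (\sum_(j < d) `|x| ^+ 2)); first exact: ler_sum.
rewrite sumr_const card_ord -[leLHS]mulr_natl exprMn ler_wpM2r ?sqr_ge0//.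
rewrite -natrX ler_nat; apply: leq_trans (leqnSn d) _.
by rewrite expnS expn1 leq_pmulr.
Qed.

Lemma nbhs_enorm x t : 0 < t -> \forall y \near x, enorm (y - x) < t.
Proof.
move=> t0; apply/nbhs_normP; exists (t / d.+1%:R) => /=.
  by rewrite divr_gt0// ltr0Sn.
move=> y /=; rewrite distrC ltr_pdivlMr ?ltr0Sn// mulrC.
exact: le_lt_trans (enorm_le_normr _).
Qed.

Lemma enorm_cvg (w : nat -> 'rV[R]_d) x :
  (forall t, 0 < t -> \forall k \near \oo, enorm (w k - x) < t) -> w @ \oo --> x.
Proof.
move=> h; apply/cvgrPdist_lt => t t0; near=> k.
rewrite distrC; apply: le_lt_trans (normr_le_enorm _) _.
by near: k; exact: h.
Unshelve. all: by end_near. Qed.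

Lemma cvg_enorm (w : nat -> 'rV[R]_d) x t : w @ \oo --> x -> 0 < t ->
  \forall k \near \oo, enorm (w k - x) < t.
Proof. by move=> wx t0; apply: (wx _ (nbhs_enorm x t0)). Qed.

End EuclideanTheory.

(** * Gradients: derivatives along lines and the quadratic upper bound *)

Section Gradient.
Context {R : realType} {d : nat}.
Implicit Types (h : 'rV[R]_d -> R) (x v : 'rV[R]_d).

Lemma diff_grad h x v : differentiable h x -> 'd h x v = dotv (grad h x) v.
Proof.
move=> hx; rewrite {1}(row_sum_delta v) linear_sum; apply: eq_bigr => j _.
by rewrite linearZ mxE deriveE// mulrC.
Qed.

Lemma is_derive_line h x v t : differentiable h (x + t *: v) ->
  is_derive t 1 (fun s => h (x + s *: v)) (dotv (grad h (x + t *: v)) v).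
Proof.
move=> hx; rewrite -diff_grad// -deriveE//.
have /= hv := @diff_derivable _ _ _ _ _ v hx.
have E : (fun s : R => s^-1 *: (h (x + (s *: (1 : R) + t) *: v) - h (x + t *: v))) =
  (fun s : R => s^-1 *: (h (s *: v + (x + t *: v)) - h (x + t *: v))).
  apply: funext => s; congr (_ *: (h _ - _)).
  by rewrite [s *: 1]mulr1 scalerDl addrCA.
by split; rewrite ?/derivable ?/derive /= E.
Qed.

(** The descent lemma without integrals: by the mean value theorem it is enough that h(x + tv) minus
    the quadratic [q] has nonpositive derivative on [0,1]. The gradient estimate is asked only along
    the segment, which stays in the convex domain of [phi]. *)
Lemma smooth_upper_bound h x v L :
  (forall t : R, 0 <= t <= 1 -> differentiable h (x + t *: v)) ->
  (forall t : R, 0 <= t <= 1 ->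
     enorm (grad h (x + t *: v) - grad h x) <= L * enorm (t *: v)) ->
  h (x + v) <= h x + dotv (grad h x) v + L / 2 * enorm v ^+ 2.
Proof.
move=> hd hL.
pose q : {poly R} := dotv (grad h x) v *: 'X + (L / 2 * enorm v ^+ 2) *: 'X^2.
pose g := (fun t => h (x + t *: v)) - horner q.
pose dg t := dotv (grad h (x + t *: v)) v - (deriv q).[t].
have dP (t : R) : 0 <= t <= 1 -> is_derive t 1 g (dg t).
  by move=> t01; apply: is_deriveB; first exact/is_derive_line/hd.
have [||c c01] := @MVT_segment R g dg 0 1 ler01.
- by move=> t; rewrite in_itv/= => /andP[? ?]; apply: dP; rewrite !ltW.
- apply: derivable_within_continuous => t; rewrite in_itv/= => t01.
  by have [] := dP _ t01.
rewrite in_itv/= in c01.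
rewrite subr0 mulr1 => E.
suff : dg c <= 0.
  rewrite -E -[g 1]/(h (x + 1 *: v) - q.[1]) -[g 0]/(h (x + 0 *: v) - q.[0]).
  by rewrite scale1r scale0r addr0 /q !(hornerD, hornerZ, hornerXn, hornerX); lra.
have := hL c c01; rewrite enormZ ger0_norm; last by case/andP: c01.
have := dotv_le_enorm (grad h (x + c *: v) - grad h x) v.
have := enorm_ge0 v; rewrite !dotvE /dg /q derivD !derivZ derivX derivXn. rewrite !(hornerD, hornerZ, hornerXn, hornerC, hornerMn, hornerX, expr1). move: (enorm v) => ev ev0.
move=> h1 /(ler_wpM2r ev0) h2.
have := le_trans h1 h2; lra.
Qed.

Lemma grad_frechet h x (e : R) : differentiable h x -> 0 < e ->
  \forall y \near x, h x + dotv (grad h x) (y - x) - e * enorm (y - x) <= h y.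
Proof.
move=> hx e0.
have /eqaddoP/(_ _ e0) := diff_locally hx.
move=> near0; rewrite (near_shift 0) subr0; near=> y => /=.
have : `|((h \o shift x) - (cst (h x) + 'd h x)) y| <= e * `|y|.
  by near: y; exact: near0.
rewrite -[(_ - _) y]/(h (y + x) - (h x + 'd h x y)) diff_grad// ler_norml addrK.
have := ler_wpM2l (ltW e0) (normr_le_enorm y); lra.
Unshelve. all: by end_near. Qed.

End Gradient.

Section Average.
Context {R : realType} {d n : nat}.
Variable f : 'I_n -> 'rV[R]_d -> R.

Lemma favgE : favg f = n%:R^-1 *: \sum_(i < n) f i.
Proof. by apply: funext => x; rewrite /favg fct_sumE. Qed.

Lemma differentiable_favg x : (forall i, differentiable (f i) x) ->
  differentiable (favg f) x.
Proof. by move=> fx; rewrite favgE; apply/differentiableZ/differentiable_sum. Qed.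

Lemma grad_favg x : (forall i, differentiable (f i) x) ->
  grad (favg f) x = n%:R^-1 *: \sum_(i < n) grad (f i) x.
Proof.
move=> fx; apply/rowP => j; rewrite !mxE favgE.
have D i : derivable (f i) x (delta_mx 0 j) by exact: diff_derivable.
rewrite deriveZ; last exact: derivable_sum.
rewrite derive_sum// summxE; congr (_ * _).
by apply: eq_bigr => i _; rewrite mxE.
Qed.

End Average.

(** * Weak subgradients and proximal points *)

(** Plays the role of the limit t -> 0 in first-order optimality arguments. *)
Lemma le0_of_le_small {R : realFieldType} (x c : R) :
  (forall t, 0 < t <= 1 -> x <= t * c) -> x <= 0.
Proof.
move=> h; rewrite leNgt; apply/negP => x0.
have c0 : 0 < c by apply: lt_le_trans x0 _; rewrite -(mul1r c) h// ltr01 lexx.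
pose t := Num.min 1 (x / (2 * c)).
have t0 : 0 < t by rewrite lt_min ltr01 divr_gt0// mulr_gt0.
have : x <= t * c by apply: h; rewrite t0 ge_min lexx.
have : t * c <= x / 2.
  by rewrite -ler_pdivlMr// -mulrA -invfM ge_min lexx orbT.
lra.
Qed.

Section WeakSubgradient.
Context {R : realType} {d : nat}.
Implicit Types (h : 'rV[R]_d -> R) (phi : 'rV[R]_d -> \bar R) (x y z w v : 'rV[R]_d).

(** For a proper [rho]-weakly convex [phi] this is the Frechet subdifferential in global form; free
    of little-o terms, it can be tested at distant points and passed to limits. *)
Definition weak_subgradient (rho : R) phi w v : Prop :=
  phi w \is a fin_num /\
  forall y, (phi w + (dotv v (y - w) - rho / 2 * enorm (y - w) ^+ 2)%:E <= phi y)%E.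

Lemma eproper_fin_num phi x : eproper phi -> edom phi x -> phi x \is a fin_num.
Proof. by move=> [phiN _] xd; rewrite fin_numE phiN -ltey. Qed.

Lemma edom_convex rho phi x v (t : R) : eproper phi -> weakly_convex rho phi ->
  edom phi x -> edom phi (x + v) -> 0 <= t <= 1 -> edom phi (x + t *: v).
Proof.
move=> pp cvx xd yd t01; have := cvx (x + v) x t t01.
have -> : t *: (x + v) + (1 - t) *: x = x + t *: v.
  by apply/rowP => j; rewrite !mxE; ring.
have := eproper_fin_num pp xd; have := eproper_fin_num pp yd.
rewrite /edom /=; case: (phi x) => // a; case: (phi (x + v)) => // b _ _.
by case: (phi (x + t *: v)) => // r; rewrite ltry.
Qed.

(** Minimality of w is tested against w + t(y - w), and weak convexity bounds [phi] there. After
    division by t the only leftover is t (1/lambda - rho)/2 |y - w|^2, which vanishes as t -> 0. *)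
Lemma prox_weak_subgradient rho phi lambda z w :
  eproper phi -> weakly_convex rho phi -> 0 < lambda ->
  w \in prox lambda phi z -> weak_subgradient rho phi w (lambda^-1 *: (z - w)).
Proof.
move=> pp cvx l0 /set_mem wp.
have wfin : phi w \is a fin_num.
  have [phiN [x0 x0d]] := pp; apply: eproper_fin_num => //.
  have := wp x0; rewrite -(fineK (eproper_fin_num pp x0d)) /edom /=.
  by case: (phi w) => // r _; rewrite ltry.
split=> // y.
have [yd|] := boolP (phi y < +oo)%E; last by rewrite -leNgt leye_eq => /eqP ->; rewrite leey.
have yfin := eproper_fin_num pp yd.
have [u yE] : exists u, y = w + u by exists (y - w); rewrite addrC subrK.
have -> : y - w = u by rewrite yE addrC addKr.
have key (t : R) : 0 < t <= 1 ->
    fine (phi w) + (dotv (lambda^-1 *: (z - w)) u - rho / 2 * enorm u ^+ 2) - fine (phi y)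
    <= t * ((lambda^-1 - rho) / 2 * enorm u ^+ 2).
  move=> /andP[t0 t1]; have t01 : 0 <= t <= 1 by rewrite ltW.
  have td : edom phi (w + t *: u).
    apply: edom_convex pp cvx _ _ t01; last by rewrite -yE.
    by move: wfin; rewrite /edom /= fin_numE ltey => /andP[].
  have tfin := eproper_fin_num pp td.
  have := wp (w + t *: u); have := cvx y w t t01.
  have -> : t *: y + (1 - t) *: w = w + t *: u.
    by rewrite yE; apply/rowP => j; rewrite !mxE; ring.
  rewrite /= -(fineK wfin) -(fineK yfin) -(fineK tfin).
  move: (fine _) (fine _) (fine _) => a b r.
  rewrite -!EFinD !lee_fin /= yE !sqr_enorm opprD addrA.
  move: (z - w) => p; rewrite !dotvE (dotvC u w) (dotvC u p) => h1 h2.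
  rewrite -(ler_pM2l t0); have l0' : lambda^-1 = 2 * (2 * lambda)^-1 by field; lra.
  rewrite l0'; move: (_^-1) h2 => m h2; lra.
rewrite -(fineK wfin) -(fineK yfin) -!EFinD lee_fin -subr_le0.
exact: (le0_of_le_small key).
Qed.

Lemma weak_subgradient_mono rho phi w1 v1 w2 v2 :
  weak_subgradient rho phi w1 v1 -> weak_subgradient rho phi w2 v2 ->
  - rho * enorm (w1 - w2) ^+ 2 <= dotv (v1 - v2) (w1 - w2).
Proof.
move=> [f1 /(_ w2) h1] [f2 /(_ w1)].
move: h1; rewrite -(fineK f1) -(fineK f2) -!EFinD !lee_fin.
by rewrite !sqr_enorm !dotvE; lra.
Qed.

Lemma weak_subgradient_le rho phi x w v :
  weak_subgradient rho phi w v -> phi x \is a fin_num ->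
  fine (phi w) + dotv v (x - w) - rho / 2 * enorm (x - w) ^+ 2 <= fine (phi x).
Proof.
move=> [f1 /(_ x)]; rewrite -(fineK f1) => h f2.
by move: h; rewrite -(fineK f2) -!EFinD !lee_fin addrA.
Qed.

Lemma weak_subgradient_subdiff rho phi h w v : 0 <= rho ->
  differentiable h w -> weak_subgradient rho phi w v ->
  subdiff (fun x => ((h x)%:E + phi x)%E) w (grad h w + v).
Proof.
move=> rho0 hw [wfin wv]; split; first by rewrite fin_numD wfin.
move=> e e0; have e20 : 0 < e / 2 by rewrite divr_gt0.
(* Within this radius the quadratic loss of the weak subgradient is at most half of e|y - w|; the
   other half pays for the linearization of [h]. The [+ 1] covers [rho = 0]. *)
have er0 : 0 < e / (rho + 1) by rewrite divr_gt0// ltr_wpDl.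
near=> y.
have h1 : h w + dotv (grad h w) (y - w) - e / 2 * enorm (y - w) <= h y.
  by near: y; exact: grad_frechet.
have : enorm (y - w) < e / (rho + 1) by near: y; exact: nbhs_enorm.
rewrite ltr_pdivlMr ?ltr_wpDl// => h2.
have h3 : rho / 2 * enorm (y - w) ^+ 2 <= e / 2 * enorm (y - w).
  have := enorm_ge0 (y - w); set n := enorm (y - w) in h2 * => n0.
  have : n * rho <= e by lra.
  by move/(ler_wpM2r n0); lra.
apply: (@le_trans _ _ ((h y)%:E + (phi w +
    (dotv v (y - w) - rho / 2 * enorm (y - w) ^+ 2)%:E))); last by rewrite leeD2l.
rewrite -(fineK wfin) -!EFinD lee_fin dotvDl; lra.
Unshelve. all: by end_near. Qed.

End WeakSubgradient.

Section ProxLipschitz.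
Context {R : realType} {d : nat}.
Variables (phi : 'rV[R]_d -> \bar R) (rho lambda : R).
Hypotheses (phi_proper : eproper phi) (phi_wcvx : weakly_convex rho phi).
Hypothesis lambda_gt0 : 0 < lambda.
Implicit Types (z w : 'rV[R]_d).

(** [lambda] times the difference of the weak subgradients is (z1 - z2) - (w1 - w2), so this is
    their monotonicity up to [rho], rescaled. *)
Lemma prox_mono z1 w1 z2 w2 : w1 \in prox lambda phi z1 -> w2 \in prox lambda phi z2 ->
  (1 - lambda * rho) * enorm (w1 - w2) ^+ 2 <= dotv (z1 - z2) (w1 - w2).
Proof.
move=> /(prox_weak_subgradient phi_proper phi_wcvx lambda_gt0) h1.
move=> /(prox_weak_subgradient phi_proper phi_wcvx lambda_gt0) h2.
have := weak_subgradient_mono h1 h2; rewrite -(ler_pM2l lambda_gt0).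
rewrite -scalerBr (dotvZl lambda^-1) mulVKf ?gt_eqF// sqr_enorm !dotvE; lra.
Qed.

Lemma prox_lip z1 w1 z2 w2 : w1 \in prox lambda phi z1 -> w2 \in prox lambda phi z2 ->
  (1 - lambda * rho) * enorm (w1 - w2) <= enorm (z1 - z2).
Proof.
move=> h1 h2; have := prox_mono h1 h2; have := dotv_le_enorm (z1 - z2) (w1 - w2).
have := enorm_ge0 (w1 - w2); rewrite le_eqVlt => /orP[/eqP <-|w0].
  by move=> _ _; rewrite mulr0 enorm_ge0.
by move=> a b; rewrite -(ler_pM2r w0) -mulrA -expr2; exact: le_trans b a.
Qed.

End ProxLipschitz.

(** * One sweep compared with frozen directions *)

Section InnerLoop.
Context {R : realType} {d : nat}.

(** With a = n alpha, a bootstrap by strong induction: if earlier displacements are at most 2aA,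
    each direction used so far has norm at most A + 2KaA <= 2A, so the next displacement is again at
    most 2aA. Each frozen direction [q0 i] is then wrong by at most 2KaA, and n steps of length
    alpha accumulate 2KA a^2. *)
Lemma inner_loop_error (n : nat) (alpha K A : R) (zi : nat -> 'rV[R]_d)
    (q q0 : 'I_n -> 'rV[R]_d) :
  0 <= alpha -> 0 <= K -> 0 <= A -> 2 * K * (n%:R * alpha) <= 1 ->
  (forall i : 'I_n, zi i.+1 = zi i - alpha *: q i) ->
  (forall i : 'I_n, enorm (q i - q0 i) <= K * enorm (zi i - zi 0%N)) ->
  (forall i : 'I_n, enorm (q0 i) <= A) ->
  enorm (zi n - zi 0%N + alpha *: \sum_(i < n) q0 i)
    <= 2 * K * A * (n%:R * alpha) ^+ 2.
Proof.
move=> a0 K0 A0 small zS qK q0A; set a := n%:R * alpha.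
have a_ge0 : 0 <= a by rewrite mulr_ge0.
have zE m (mn : (m <= n)%N) :
    zi m - zi 0%N = - (alpha *: \sum_(i < m) q (widen_ord mn i)).
  elim: m mn => [|m IH] mn; first by rewrite big_ord0 scaler0 oppr0 subrr.
  rewrite big_ord_recr /= scalerDr opprD.
  have -> : widen_ord mn ord_max = Ordinal mn by exact: val_inj.
  rewrite (zS (Ordinal mn)) /= addrAC (IH (ltnW mn)).
  by do 3 f_equal; apply: eq_bigr => i _; congr q; exact: val_inj.
have dist m (mn : (m <= n)%N) : enorm (zi m - zi 0%N) <= 2 * a * A.
  elim/ltn_ind: m mn => m IH mn.
  rewrite zE enormN enormZ ger0_norm//.
  have : enorm (\sum_(i < m) q (widen_ord mn i)) <= \sum_(i < m) (2 * A).
    apply: le_trans (ler_enorm_sum _ _ _) _; apply: ler_sum => i _.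
    set j := widen_ord mn i; rewrite -(subrK (q0 j) (q j)).
    apply: le_trans (ler_enormD _ _) _.
    have h1 : K * enorm (zi j - zi 0%N) <= K * (2 * a * A).
      by apply: ler_wpM2l => //; apply: IH => //=; exact: ltnW (leq_trans (ltn_ord i) mn).
    have := ler_wpM2r A0 small; rewrite -/a.
    have := qK j; have := q0A j; lra.
  rewrite sumr_const card_ord -mulr_natl => /(ler_wpM2l a0) /le_trans; apply.
  rewrite /a; have : m%:R <= n%:R :> R by rewrite ler_nat.
  by move=> /(ler_wpM2r (mulr_ge0 a0 A0)); lra.
have -> : zi n - zi 0%N + alpha *: \sum_(i < n) q0 i =
    alpha *: \sum_(i < n) (q0 i - q i).
  rewrite (zE n (leqnn n)) addrC -scalerBr; congr (_ *: _); rewrite sumrB.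
  by congr (_ - _); apply: eq_bigr => i _; congr q; exact: val_inj.
rewrite enormZ ger0_norm//.
have : enorm (\sum_(i < n) (q0 i - q i)) <= \sum_(i < n) K * (2 * a * A).
  apply: le_trans (ler_enorm_sum _ _ _) _; apply: ler_sum => i _.
  rewrite enormB; apply: le_trans (qK i) _.
  by apply: ler_wpM2l => //; apply: dist; exact: ltnW.
rewrite sumr_const card_ord -mulr_natl => /(ler_wpM2l a0) /le_trans; apply.
by rewrite /a; lra.
Qed.

End InnerLoop.

(** * The scalar inequality behind the descent *)

Section MeritDescent.
Context {R : realType}.

(** Here x, y, e stand for |F|, |w' - w| and the sweep error. Writing y = aY and e = aE factors out
    a, and Young's inequality splits every product. The x^2 coefficients add up as -tau + tau/2 +
    tau/8 + tau/8 + tau/8 = -tau/8, and Y^2 keeps at least -1/4. *)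
Lemma merit_scalar_bound (L rho lambda m tau a x y e M : R) :
  0 < L -> 0 < rho -> 0 < lambda -> lambda * m = 1 -> 0 < a ->
  0 <= x -> 0 <= y -> 0 <= e ->
  0 < tau -> 4 * (tau * (1 + (lambda * L) ^+ 2)) <= 1 ->
  a * (m + (L + rho) / 2 + 3 / 2 * (lambda * (L + m) ^+ 2)) <= tau / 8 ->
  14 * (M * a) ^+ 2 <= tau / 8 ->
  e <= M * a ^+ 2 * (x + 1) ->
  (1 - tau) * ((e * y - 3 / 4 * y ^+ 2) / a) + tau * (- a * x ^+ 2 + x * e)
  + tau * lambda * (x * (L * y)) + m * ((a * x + e) * y) + (L + rho) / 2 * y ^+ 2
  + tau * lambda / 2 * ((L + m) * y + m * (a * x + e)) ^+ 2
  <= - (tau / 8) * (a * x ^+ 2) - (y ^+ 2 / a) / 4 + 14 * M ^+ 2 * a ^+ 3.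
Proof.
move=> L0 r0 l0 lm a0 x0 y0 e0 t0 tL aK aM eM.
have m0 : 0 < m by rewrite -(pmulr_rgt0 _ l0) lm.
have lL2 := sqr_ge0 (lambda * L).
have t14 : 4 * tau <= 1.
  by have := mulr_ge0 (ltW t0) lL2; lra.
pose Y := y / a; pose E := e / a.
have yE : y = a * Y by rewrite /Y mulrC divfK ?gt_eqF.
have eE : e = a * E by rewrite /E mulrC divfK ?gt_eqF.
have Y0 : 0 <= Y by rewrite divr_ge0// ltW.
have E0 : 0 <= E by rewrite divr_ge0// ltW.
(* The total coefficient of E^2 below stays under 7, and the factor 2 here turns this into the
   constant 14. *)
have E2 : E ^+ 2 <= 2 * (M * a) ^+ 2 * (x ^+ 2 + 1).
  have EM : E <= M * a * (x + 1).
    by rewrite -(ler_pM2l a0) -eE; apply: le_trans eM _; lra.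
  have h : E ^+ 2 <= (M * a * (x + 1)) ^+ 2.
    by rewrite ler_pXn2r// nnegrE// (le_trans _ EM).
  apply: le_trans h _; rewrite exprMn; set s := (M * a) ^+ 2.
  have s0 : 0 <= s by rewrite sqr_ge0.
  have : 0 <= s * (x - 1) ^+ 2 by rewrite mulr_ge0 ?sqr_ge0.
  by lra.
set S := x ^+ 2 + Y ^+ 2 + E ^+ 2.
have S0 : 0 <= S by rewrite !addr_ge0 ?sqr_ge0.
have Q1 : m * ((x + E) * Y) <= m * S.
  apply: ler_wpM2l; first exact: ltW.
  have := sqr_ge0 (x - Y); have := sqr_ge0 (E - Y).
  have := sqr_ge0 x; have := sqr_ge0 E; rewrite /S; lra.
have Q2 : (L + rho) / 2 * Y ^+ 2 <= (L + rho) / 2 * S.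
  apply: ler_wpM2l; first lra.
  by have := sqr_ge0 x; have := sqr_ge0 E; rewrite /S; lra.
have Q3 : tau * lambda / 2 * ((L + m) * Y + m * (x + E)) ^+ 2
    <= 3 / 2 * (lambda * (L + m) ^+ 2) * S.
  have h1 : (L + m) * Y + m * (x + E) <= (L + m) * (x + Y + E).
    have := mulr_ge0 (ltW L0) (addr_ge0 x0 E0); lra.
  have h2 : ((L + m) * Y + m * (x + E)) ^+ 2 <= ((L + m) * (x + Y + E)) ^+ 2.
    rewrite ler_pXn2r// nnegrE; last by rewrite mulr_ge0 ?addr_ge0//; lra.
    by rewrite addr_ge0// mulr_ge0 ?addr_ge0//; lra.
  have h3 : (x + Y + E) ^+ 2 <= 3 * S.
    have := sqr_ge0 (x - Y); have := sqr_ge0 (E - Y); have := sqr_ge0 (x - E).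
    rewrite /S; lra.
  have h4 : ((L + m) * Y + m * (x + E)) ^+ 2 <= (L + m) ^+ 2 * (3 * S).
    by apply: le_trans h2 _; rewrite exprMn; apply: ler_wpM2l => //; exact: sqr_ge0.
  have h5 : 0 <= lambda * ((L + m) ^+ 2 * (3 * S)).
    by apply: mulr_ge0; [exact: ltW | rewrite mulr_ge0 ?sqr_ge0// mulr_ge0].
  have h6 : tau * lambda / 2 * ((L + m) * Y + m * (x + E)) ^+ 2 <=
            tau * lambda / 2 * ((L + m) ^+ 2 * (3 * S)).
    by apply: ler_wpM2l => //; rewrite divr_ge0// mulr_ge0// ltW.
  apply: le_trans h6 _.
  have : tau * (lambda * ((L + m) ^+ 2 * (3 * S))) <=
      1 * (lambda * ((L + m) ^+ 2 * (3 * S))) by apply: ler_wpM2r => //; lra.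
  by lra.
have Q : a * (m * ((x + E) * Y) + (L + rho) / 2 * Y ^+ 2
     + tau * lambda / 2 * ((L + m) * Y + m * (x + E)) ^+ 2) <= tau / 8 * S.
  have := ler_wpM2l (ltW a0) (lerD (lerD Q1 Q2) Q3).
  by move/le_trans; apply; have := ler_wpM2r S0 aK; lra.
have P1 : tau * lambda * (x * (L * Y)) <= tau * x ^+ 2 / 2 + Y ^+ 2 / 8.
  have h1 := mulr_ge0 (ltW t0) (sqr_ge0 (x - lambda * L * Y)).
  have : tau * (lambda * L) ^+ 2 * Y ^+ 2 <= 1 / 4 * Y ^+ 2.
    by apply: ler_wpM2r; [exact: sqr_ge0|lra].
  by lra.
have P2 : (1 - tau) * (E * Y - 3 / 4 * Y ^+ 2) <= 4 * E ^+ 2 - 1 / 2 * Y ^+ 2.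
  have h : E * Y <= Y ^+ 2 / 16 + 4 * E ^+ 2 by have := sqr_ge0 (Y / 4 - 2 * E); lra.
  have h' : (1 - tau) * (E * Y) <= (1 - tau) * (Y ^+ 2 / 16 + 4 * E ^+ 2).
    by apply: ler_wpM2l => //; lra.
  have := mulr_ge0 (ltW t0) (sqr_ge0 E).
  have : tau * Y ^+ 2 <= 1 / 4 * Y ^+ 2.
    by apply: ler_wpM2r; [exact: sqr_ge0|lra].
  by have := sqr_ge0 Y; lra.
have P3 : tau * (x * E) <= tau * x ^+ 2 / 8 + E ^+ 2 / 2.
  have : tau * E ^+ 2 <= 1 / 4 * E ^+ 2.
    by apply: ler_wpM2r; [exact: sqr_ge0|lra].
  have := mulr_ge0 (ltW t0) (sqr_ge0 x).
  have := mulr_ge0 (ltW t0) (sqr_ge0 (x / 2 - 2 * E)).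
  by have := sqr_ge0 E; lra.
have main : (1 - tau) * (E * Y - 3 / 4 * Y ^+ 2) + tau * (- x ^+ 2 + x * E)
  + tau * lambda * (x * (L * Y)) + a * (m * ((x + E) * Y) + (L + rho) / 2 * Y ^+ 2
  + tau * lambda / 2 * ((L + m) * Y + m * (x + E)) ^+ 2)
  <= - (tau / 8) * x ^+ 2 - Y ^+ 2 / 4 + 14 * (M * a) ^+ 2.
  have hx : 7 * E ^+ 2 <= tau / 8 * x ^+ 2 + 14 * (M * a) ^+ 2.
    have := ler_wpM2r (sqr_ge0 x) aM; have := E2; lra.
  have := sqr_ge0 E.
  have : tau * E ^+ 2 <= 1 / 4 * E ^+ 2.
    by apply: ler_wpM2r; [exact: sqr_ge0|lra].
  have : tau * Y ^+ 2 <= 1 / 4 * Y ^+ 2.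
    by apply: ler_wpM2r; [exact: sqr_ge0|lra].
  by move: Q; rewrite /S; have := sqr_ge0 Y; lra.
have := ler_wpM2l (ltW a0) main.
rewrite yE eE (_ : (a * E * (a * Y) - 3 / 4 * (a * Y) ^+ 2) / a =
  a * (E * Y - 3 / 4 * Y ^+ 2)); last by field; rewrite gt_eqF.
rewrite (_ : (a * Y) ^+ 2 / a = a * Y ^+ 2); last by field; rewrite gt_eqF.
by lra.
Qed.

End MeritDescent.

(** * Descent of the merit function *)

Section NormalMapStep.
Context {R : realType} {d : nat}.
Variables (h : 'rV[R]_d -> R) (phi : 'rV[R]_d -> \bar R) (L rho lambda : R).
Hypotheses (h_diff : forall x, differentiable h x) (L_gt0 : 0 < L).
Hypothesis h_lip : forall x y, edom phi x -> edom phi y ->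
  enorm (grad h x - grad h y) <= L * enorm (x - y).
Hypotheses (rho_gt0 : 0 < rho) (phi_wcvx : weakly_convex rho phi).
Hypotheses (phi_proper : eproper phi).
Hypotheses (lambda_gt0 : 0 < lambda) (lambda_rho : 4 * (lambda * rho) <= 1).

Definition normal_map (z w : 'rV[R]_d) := grad h w + lambda^-1 *: (z - w).

(** Real-valued through [fine], which is faithful at proximal points because [phi] is finite
    there. *)
Definition merit (tau : R) (z w : 'rV[R]_d) :=
  h w + fine (phi w) + tau * lambda / 2 * enorm (normal_map z w) ^+ 2.

(** With D = w' - w and Z = z' - z, the smooth bound at w and the weak subgradient at w' give a
    change of [psi] of at most <F,D> + m<Z,D> + (L + rho)/2 |D|^2, where m = 1/lambda. The cross
    term of the squared normal map gives tau (lambda<F,g> + <F,Z> - <F,D>), with g the change of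
    gradient. Since aF = e - Z, the remaining (1 - tau)<F,D> is negative up to the error e, and
    tau<F,Z> supplies -tau a|F|^2. *)
Lemma merit_descent tau a M z w z' w' e :
  w \in prox lambda phi z -> w' \in prox lambda phi z' ->
  z' = z - a *: normal_map z w + e ->
  enorm e <= M * a ^+ 2 * (enorm (normal_map z w) + 1) ->
  0 < a -> 0 < tau -> 4 * (tau * (1 + (lambda * L) ^+ 2)) <= 1 ->
  a * (lambda^-1 + (L + rho) / 2 + 3 / 2 * (lambda * (L + lambda^-1) ^+ 2)) <= tau / 8 ->
  14 * (M * a) ^+ 2 <= tau / 8 ->
  merit tau z' w' <= merit tau z w - tau / 8 * (a * enorm (normal_map z w) ^+ 2)
    - enorm (w' - w) ^+ 2 / a / 4 + 14 * M ^+ 2 * a ^+ 3.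
Proof.
move=> wz wz' z'E eM a0 t0 tL aK aM.
have sw := prox_weak_subgradient phi_proper phi_wcvx lambda_gt0 wz.
have sw' := prox_weak_subgradient phi_proper phi_wcvx lambda_gt0 wz'.
have mono := prox_mono phi_proper phi_wcvx lambda_gt0 wz' wz.
have fin_edom x : phi x \is a fin_num -> edom phi x.
  by rewrite /edom /= fin_numE ltey => /andP[].
have wd : edom phi w by apply: fin_edom; have [] := sw.
have wd' : edom phi w' by apply: fin_edom; have [] := sw'.
have hdes : h w' <= h w + dotv (grad h w) (w' - w) + L / 2 * enorm (w' - w) ^+ 2.
  have -> : h w' = h (w + (w' - w)) by rewrite addrC subrK.
  apply: smooth_upper_bound => // t t01.
  have tE : t *: (w' - w) = w + t *: (w' - w) - w by rewrite addrAC subrr add0r.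
  rewrite [X in L * enorm X]tE; apply: h_lip => //.
  by apply: edom_convex phi_proper phi_wcvx _ _ t01; rewrite // addrC subrK.
have pdes := weak_subgradient_le sw' (proj1 sw).
have glip := h_lip wd' wd.
have mE : lambda * lambda^-1 = 1 by rewrite divff// gt_eqF.
rewrite /merit; set F := normal_map z w in z'E eM *.
set F' := normal_map z' w'; set m := lambda^-1 in mE pdes aK *.
set D := w' - w in mono hdes pdes glip *; set Z := z' - z in mono *.
have ZE : Z = - (a *: F) + e by rewrite /Z z'E; apply/rowP => j; rewrite !mxE; ring.
set g := grad h w' - grad h w in glip.
have F'E : F' = F + (g + m *: (Z - D)).
  by rewrite /F' /F /normal_map /g /Z /D; apply/rowP => j; rewrite !mxE -/m; ring.
set r := g + _ in F'E.
have vE : m *: (z' - w') = F - grad h w + m *: (Z - D).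
  by rewrite /F /normal_map /Z /D; apply/rowP => j; rewrite !mxE -/m; ring.
have DE : w - w' = - D by rewrite /D opprB.
rewrite {}vE {}DE enormN in pdes.
have rE : r = g + m *: (Z - D) by [].
clearbody r g F' F Z D.
rewrite !dotvE in pdes.
set x := enorm F; set y := enorm D in mono hdes pdes glip *; set ee := enorm e in eM.
have x0 : 0 <= x := enorm_ge0 _; have y0 : 0 <= y := enorm_ge0 _.
have e0 : 0 <= ee := enorm_ge0 _.
have B := merit_scalar_bound L_gt0 rho_gt0 lambda_gt0 mE a0 x0 y0 e0 t0 tL aK aM eM.
(* The 3/4 is the lower bound for 1 - lambda rho in the monotonicity of the prox. *)
have dFD : dotv F D <= (ee * y - 3 / 4 * y ^+ 2) / a.
  rewrite ler_pdivlMr// mulrC.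
  have : a * dotv F D = dotv e D - dotv Z D by rewrite ZE !dotvE; ring.
  have := dotv_le_enorm e D; rewrite -/ee -/y.
  have : 4 * (lambda * rho) * y ^+ 2 <= 1 * y ^+ 2 by rewrite ler_wpM2r ?sqr_ge0.
  by lra.
have dFZ : dotv F Z <= - a * x ^+ 2 + x * ee.
  by rewrite ZE !dotvE /x sqr_enorm; have := dotv_le_enorm F e; rewrite -/x -/ee; lra.
have dFg : dotv F g <= x * (L * y).
  by apply: le_trans (dotv_le_enorm _ _) _; rewrite ler_wpM2l.
have nZ : enorm Z <= a * x + ee.
  by rewrite ZE; apply: le_trans (ler_enormD _ _) _; rewrite enormN enormZ gtr0_norm.
have dZD : dotv Z D <= (a * x + ee) * y.
  by apply: le_trans (dotv_le_enorm _ _) _; rewrite ler_wpM2r.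
have m0 : 0 < m by rewrite invr_gt0.
have nr : enorm r <= (L + m) * y + m * (a * x + ee).
  rewrite rE; apply: le_trans (ler_enormD _ _) _; rewrite enormZ gtr0_norm//.
  have := ler_enormD Z (- D); rewrite enormN -/y => h1.
  have : m * enorm (Z - D) <= m * (a * x + ee + y).
    by apply: ler_wpM2l (ltW m0) _ _ _; apply: le_trans h1 _; rewrite lerD2r.
  by lra.
have nr2 : enorm r ^+ 2 <= ((L + m) * y + m * (a * x + ee)) ^+ 2.
  by rewrite ler_pXn2r// nnegrE ?enorm_ge0// (le_trans _ nr) ?enorm_ge0.
have F'2 : enorm F' ^+ 2 = x ^+ 2 + 2 * dotv F r + enorm r ^+ 2.
  by rewrite F'E !sqr_enorm [dotv (F + r) _]dotvDl !dotvDr (dotvC r F); ring.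
have lFr : lambda * dotv F r = lambda * dotv F g + dotv F Z - dotv F D.
  have -> : dotv F r = dotv F g + m * (dotv F Z - dotv F D) by rewrite rE !dotvE; ring.
  by rewrite mulrDr mulrA mE mul1r addrA.
have tl : 0 <= tau * lambda / 2 by rewrite divr_ge0// mulr_ge0// ltW.
have u1 := ler_wpM2l tl nr2.
have u2 := ler_wpM2l (mulr_ge0 (ltW t0) (ltW lambda_gt0)) dFg.
have u3 := ler_wpM2l (ltW t0) dFZ.
have u4 := ler_wpM2l (ltW m0) dZD.
have t1 : 0 <= 1 - tau.
  by have := mulr_ge0 (ltW t0) (sqr_ge0 (lambda * L)); lra.
have u5 := ler_wpM2l t1 dFD.
have u6 : 0 <= m * y ^+ 2 by rewrite mulr_ge0 ?sqr_ge0// ltW.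
have F'3 : tau * lambda / 2 * enorm F' ^+ 2 = tau * lambda / 2 * x ^+ 2 +
   tau * (lambda * dotv F g + dotv F Z - dotv F D) + tau * lambda / 2 * enorm r ^+ 2.
  by rewrite F'2 -lFr; field.
have ddD : dotv D D = y ^+ 2 by rewrite sqr_enorm.
rewrite F'3; rewrite ddD in pdes.
by lra.
Qed.

Lemma normal_map_subdiff z w : w \in prox lambda phi z ->
  subdiff (fun x => ((h x)%:E + phi x)%E) w (normal_map z w).
Proof.
move=> wz; apply: (@weak_subgradient_subdiff _ _ rho) => //; first exact: ltW.
exact: prox_weak_subgradient wz.
Qed.

End NormalMapStep.

(** * Summability from descent and the KL inequality *)

Section RealSequences.
Context {R : realType}.
Implicit Types (u v a x y t : nat -> R).

(** Summability for nonnegative terms, kept in the reals so that linear arithmetic applies; extended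
    series are converted only at the two ends of the proof. *)
Definition bounded_sums u := exists B : R, forall n, \sum_(0 <= i < n) u i <= B.

Lemma bounded_sumsD u v : bounded_sums u -> bounded_sums v ->
  bounded_sums (fun k => u k + v k).
Proof.
by move=> [A hA] [B hB]; exists (A + B) => n; rewrite big_split lerD.
Qed.

Lemma bounded_sumsZ (c : R) u : 0 <= c -> bounded_sums u ->
  bounded_sums (fun k => c * u k).
Proof.
by move=> c0 [A hA]; exists (c * A) => n; rewrite -big_distrr ler_wpM2l.
Qed.

Lemma bounded_sums_le N u v : (forall k, 0 <= v k) ->
  (forall k, (N <= k)%N -> u k <= v k) -> bounded_sums v -> bounded_sums u.
Proof.
move=> v0 uv [B hB]; exists (\sum_(0 <= i < N) `|u i| + B) => n.
have [nN|Nn] := leqP n N.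
  have B0 : 0 <= B by have := hB 0%N; rewrite big_geq.
  apply: (@le_trans _ _ (\sum_(0 <= i < N) `|u i|)); last by rewrite lerDl.
  rewrite (big_cat_nat (leq0n n) nN)//=; apply: ler_wpDr; first exact: sumr_ge0.
  by apply: ler_sum => i _; exact: ler_norm.
rewrite (big_cat_nat (leq0n N) (ltnW Nn))//=; apply: lerD.
  by apply: ler_sum => i _; exact: ler_norm.
apply: (@le_trans _ _ (\sum_(0 <= i < n) v i)) => //.
rewrite (big_cat_nat (leq0n N) (ltnW Nn))//=; apply: ler_wpDl; first exact: sumr_ge0.
by apply: ler_sum_nat => i /andP[/uv].
Qed.

Lemma bounded_sums_telescope N u v (m : R) : (forall k, (N <= k)%N -> v k <= u k - u k.+1) ->
  (forall k, (N <= k)%N -> 0 <= v k) ->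
  (forall k, (N <= k)%N -> m <= u k) -> bounded_sums v.
Proof.
move=> vu v0 um.
(* Nothing is known before [N]; cutting off there leaves a purely telescoping sum. *)
pose v' k := if (N <= k)%N then v k else 0.
have : bounded_sums v'.
  exists (u N - m) => n.
  have le n' : (N <= n')%N -> \sum_(0 <= i < n') v' i <= u N - u n'.
    move=> Nn'; rewrite (big_cat_nat (leq0n N) Nn')//= big_nat big1 ?add0r; last first.
      by move=> i /andP[_ iN]; rewrite /v' leqNgt iN.
    rewrite -(subnKC Nn'); elim: (_ - _)%N => [|j IH].
      by rewrite addn0 big_geq// subrr.
    rewrite addnS big_nat_recr ?leq_addr//= {2}/v' leq_addr.
    have := vu (N + j)%N (leq_addr _ _); move: IH; lra.
  have [nN|/ltnW Nn] := leqP n N; last first.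
    by have := le _ Nn; have := um _ Nn; lra.
  rewrite big_nat big1 ?subr_ge0 ?um// => i /andP[_ iN].
  by rewrite /v' leqNgt (leq_trans iN).
apply: (@bounded_sums_le N) => k; rewrite /v'; last by move=> ->.
by case: ifP => // /v0.
Qed.

(** A positive limit l would force x_k >= l/2 eventually, hence a_k <= (2/l) a_k x_k, and the
    weights would be summable. *)
Lemma cvg_divergent_weights_eq0 a x (l : R) : (forall k, 0 < a k) ->
  ~ bounded_sums a -> (forall k, 0 <= x k) ->
  bounded_sums (fun k => a k * x k) -> x @ \oo --> l -> l = 0.
Proof.
move=> a0 aoo x0 axB xl.
have l0 : 0 <= l.
  rewrite -(cvg_lim (@Rhausdorff R) xl); apply: limr_ge; last exact: nearW.
  by apply/cvg_ex; exists l.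
apply/eqP; rewrite eq_le l0 andbT leNgt; apply/negP => lp; apply: aoo.
have : \forall k \near \oo, l / 2 <= x k.
  by apply: (cvgr_ge _ xl); rewrite ltr_pdivrMr// ltr_pMr// ltr1n.
move=> [N _ xN]; apply: (@bounded_sums_le N _ (fun k => 2 / l * (a k * x k))).
- by move=> k; rewrite mulr_ge0 ?divr_ge0// mulr_ge0// ltW.
- move=> k /xN /= /(ler_wpM2l (ltW (a0 k))) h.
  rewrite -(ler_pM2l lp) (_ : l * (2 / l * _) = 2 * (a k * x k)); first lra.
  by field; rewrite gt_eqF.
- by apply: bounded_sumsZ => //; rewrite divr_ge0.
Qed.

Lemma near_antitone_cvg N u (m : R) : (forall k, (N <= k)%N -> u k.+1 <= u k) ->
  (forall k, (N <= k)%N -> m <= u k) ->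
  exists2 l : R, u @ \oo --> l & forall k, (N <= k)%N -> l <= u k.
Proof.
move=> udec um; pose v k := u (k + N)%N.
have vdec : {homo v : i j / (i <= j)%N >-> j <= i}.
  move=> i j ij; rewrite /v -(subnKC ij); elim: (j - i)%N => [|p IH].
    by rewrite addn0.
  by rewrite addnS addSn (le_trans _ IH)// udec// leq_addl.
have vcvg : cvgn v.
  by apply: nonincreasing_is_cvgn => //; exists m => _ [k _ <-]; apply/um/leq_addl.
exists (limn v); first by rewrite -(cvg_shiftn N).
by move=> k Nk; rewrite -(subnK Nk); apply: (nonincreasing_cvgn_ge vdec vcvg).
Qed.

Section Descent.
Variables (N : nat) (a x y t r psi : nat -> R) (m : R).
Hypothesis a_gt0 : forall k, 0 < a k.
Hypotheses (t_ge0 : forall k, 0 <= t k) (t_rec : forall k, t k = t k.+1 + r k).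
Hypotheses (t_cvg0 : t @ \oo --> 0) (psi_lb : forall k, m <= psi k).

Definition descends (s c1 c3 : R) := forall k, (N <= k)%N ->
  psi k.+1 + s * x k.+1 ^+ 2 <=
  psi k + s * x k ^+ 2 - c1 * (a k * x k ^+ 2) - y k ^+ 2 / a k / 4 + c3 * r k.

Lemma descends_cvg (s c1 c3 : R) : 0 <= s -> 0 < c1 -> 0 <= c3 -> descends s c1 c3 ->
  (exists l : R, (fun k => psi k + s * x k ^+ 2) @ \oo --> l) /\
  bounded_sums (fun k => a k * x k ^+ 2).
Proof.
move=> s0 c10 c30 desc; pose E k := psi k + s * x k ^+ 2 + c3 * t k.
have ya k : 0 <= y k ^+ 2 / a k / 4.
  by rewrite divr_ge0// divr_ge0 ?sqr_ge0// ltW.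
have ax k : 0 <= a k * x k ^+ 2 by rewrite mulr_ge0 ?sqr_ge0// ltW.
have Edec k : (N <= k)%N -> c1 * (a k * x k ^+ 2) <= E k - E k.+1.
  by move=> /desc; rewrite /E (t_rec k); have := ya k; lra.
have Elb k : m <= E k.
  have := mulr_ge0 s0 (sqr_ge0 (x k)); have := mulr_ge0 c30 (t_ge0 k).
  by rewrite /E; have := psi_lb k; lra.
have [|l El _] := @near_antitone_cvg N E m _ (fun k _ => Elb k).
  move=> k /Edec; have : 0 <= c1 * (a k * x k ^+ 2) by rewrite mulr_ge0// ltW.
  lra.
split.
  exists l; have -> : (fun k => psi k + s * x k ^+ 2) = E \- (fun k => c3 * t k).
    by apply: funext => k; rewrite /E /= addrK.
  rewrite -[l]subr0 -[0](mulr0 c3); apply: cvgB => //; apply: cvgM => //; exact: cvg_cst.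
have : bounded_sums (fun k => c1 * (a k * x k ^+ 2)).
  apply: (bounded_sums_telescope Edec) => [k _|k _]; last exact: Elb.
  by rewrite mulr_ge0// ltW.
move=> /(@bounded_sumsZ c1^-1 _); rewrite invr_ge0 ltW// => /(_ isT).
by under eq_fun do rewrite mulKf ?gt_eqF//.
Qed.

(* The descent holds for two distinct weights [s], so both [psi] and [x ^+ 2]
   converge; this replaces the usual crossing argument for [x --> 0]. *)
Lemma two_weights_cvg (s1 s2 c1 c2 c3 : R) : ~ bounded_sums a -> 0 <= s1 < s2 ->
  0 < c1 -> 0 < c2 -> 0 <= c3 -> descends s1 c1 c3 -> descends s2 c2 c3 ->
  x @ \oo --> 0 /\ exists l : R, psi @ \oo --> l.
Proof.
move=> aoo /andP[s10 s12] c10 c20 c30 d1 d2.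
have [[l1 h1] bs] := descends_cvg s10 c10 c30 d1.
have [[l2 h2] _] := descends_cvg (le_trans s10 (ltW s12)) c20 c30 d2.
have s21 : 0 < s2 - s1 by rewrite subr_gt0.
have x2 : (fun k => x k ^+ 2) @ \oo --> (s2 - s1)^-1 * (l2 - l1).
  rewrite [X in X @ _ --> _](_ : _ = fun k => (s2 - s1)^-1 *
    ((psi k + s2 * x k ^+ 2) - (psi k + s1 * x k ^+ 2))); last first.
    by apply: funext => k; field; rewrite gt_eqF.
  by apply: cvgM; [exact: cvg_cst | exact: cvgB].
have x20 : (fun k => x k ^+ 2) @ \oo --> 0.
  rewrite -(cvg_divergent_weights_eq0 a_gt0 aoo _ bs x2)// => k.
  exact: sqr_ge0.
split.
  apply/cvgrPdist_lt => e e0; have e20 : 0 < e ^+ 2 by rewrite exprn_gt0.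
  have /cvgrPdist_lt/(_ _ e20) := x20.
  apply: filterS => k; rewrite !sub0r !normrN normrX.
  by rewrite ltr_pXn2r// nnegrE ?ltW.
exists l1; rewrite [X in X @ _ --> _](_ : _ = fun k =>
  (psi k + s1 * x k ^+ 2) - s1 * x k ^+ 2); last by apply: funext => k; rewrite addrK.
by rewrite -[l1]subr0 -[0](mulr0 s1); apply: cvgB => //; apply: cvgM => //; exact: cvg_cst.
Qed.

End Descent.

(** The tangent inequality of the concave s^(1 - theta) at u, multiplied by u^theta so that u = 0 is
    allowed. It is Young's inequality u^theta v^(1 - theta) <= theta u + (1 - theta) v. *)
Lemma powR_concave_bound (theta u v : R) : 0 < theta < 1 -> 0 <= u -> 0 <= v ->
  (1 - theta) * (u - v) <= u `^ theta * (u `^ (1 - theta) - v `^ (1 - theta)).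
Proof.
move=> /andP[t0 t1] u0 v0; have t1' : 0 < 1 - theta by rewrite subr_gt0.
have uE : u `^ theta * u `^ (1 - theta) = u.
  have [->|un0] := eqVneq u 0; first by rewrite !powR0 ?mulr0// gt_eqF.
  rewrite -powRD; last by rewrite un0 implybT.
  by rewrite addrC subrK powRr1.
have := @conjugate_powR R (u `^ theta) (v `^ (1 - theta)) theta^-1 (1 - theta)^-1.
rewrite !powR_ge0 !invr_gt0 t0 t1' !invrK addrC subrK => /(_ isT isT isT isT erefl).
rewrite -!powRrM !divff ?gt_eqF// !powRr1// [_ `^ theta * (_ - _)]mulrBr uE; lra.
Qed.

(** Concavity turns the drop of [delta] into at most C D_k (x_k + b_k) with D_k telescoping. If x_k
    <= b_k then a_k x_k <= a_k b_k; otherwise the descent can be divided by x_k and gives a_k x_k <=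
    (2C/c1) D_k. For y, the descent has the form y_k^2 <= pq with p a multiple of D_k and q = a_k
    x_k + a_k b_k, so y_k <= p + q. *)
Lemma KL_bounded_sums N a x y t b delta (theta C c1 : R) :
  (forall k, 0 < a k) -> (forall k, 0 <= x k) -> (forall k, 0 <= y k) ->
  (forall k, 0 <= b k) -> 0 < theta < 1 -> 0 < C -> 0 < c1 ->
  (forall k, (N <= k)%N -> 0 <= delta k) ->
  (forall k, (N <= k)%N -> c1 * (a k * x k ^+ 2) + y k ^+ 2 / a k / 4 <=
     delta k - delta k.+1) ->
  (forall k, (N <= k)%N -> delta k `^ theta <= C * (x k + b k)) ->
  bounded_sums (fun k => a k * b k) ->
  bounded_sums (fun k => a k * x k) /\ bounded_sums y.
Proof.
move=> a0 x0 y0 b0 th C0 c10 d0 ddec dKL abB.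
have /andP[th0 th1] := th; have th1' : 0 < 1 - theta by rewrite subr_gt0.
pose D k := (delta k `^ (1 - theta) - delta k.+1 `^ (1 - theta)) / (1 - theta).
have axy k : 0 <= a k * x k ^+ 2 by rewrite mulr_ge0 ?sqr_ge0// ltW.
have ya k : 0 <= y k ^+ 2 / a k / 4.
  by rewrite divr_ge0// divr_ge0 ?sqr_ge0// ltW.
have caxy k : 0 <= c1 * (a k * x k ^+ 2) by rewrite mulr_ge0// ltW.
have dS k : (N <= k)%N -> delta k.+1 <= delta k.
  by move=> /ddec; have := caxy k; have := ya k; lra.
have D0 k : (N <= k)%N -> 0 <= D k.
  move=> Nk; rewrite divr_ge0 ?(ltW th1')// subr_ge0.
  by apply: ge0_ler_powR; rewrite ?nnegrE ?(ltW th1') ?d0 ?dS// leqW.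
have dD k : (N <= k)%N -> delta k - delta k.+1 <= C * D k * (x k + b k).
  move=> Nk; rewrite -(ler_pM2l th1').
  apply: le_trans (powR_concave_bound th (d0 _ Nk) (d0 _ (leqW Nk))) _.
  rewrite (_ : _ - _ = (1 - theta) * D k); last by rewrite mulrC divfK ?gt_eqF.
  have := ler_wpM2l (ltW th1') (ler_wpM2r (D0 _ Nk) (dKL _ Nk)); lra.
pose D' k := if (N <= k)%N then D k else 0.
have D'0 k : 0 <= D' k by rewrite /D'; case: ifP => // /D0.
have DB : bounded_sums D'.
  apply: (@bounded_sums_telescope N (fun k => delta k `^ (1 - theta) / (1 - theta)) _ 0).
  - by move=> k Nk; rewrite /D' Nk /D mulrBl.
  - by move=> k _; exact: D'0.
  - by move=> k _; rewrite divr_ge0 ?powR_ge0 ?(ltW th1').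
have c0 : 0 <= 2 * C / c1 by rewrite divr_ge0 ?(ltW c10)// mulr_ge0// ltW.
have c4 : 0 <= 4 * C by rewrite mulr_ge0// ltW.
have ab0 k : 0 <= a k * b k by rewrite mulr_ge0// ltW.
have ax0 k : 0 <= a k * x k by rewrite mulr_ge0// ltW.
have axB : bounded_sums (fun k => a k * x k).
  apply: (@bounded_sums_le N _ (fun k => 2 * C / c1 * D' k + a k * b k)).
  - by move=> k; rewrite addr_ge0// mulr_ge0.
  - move=> k Nk; rewrite /D' Nk; have [xb|bx] := leP (x k) (b k).
      apply: ler_wpDl; last by rewrite ler_wpM2l// ltW.
      by rewrite mulr_ge0 ?D0.
    apply: ler_wpDr => //.
    have xp : 0 < x k by exact: le_lt_trans bx.
    rewrite -(ler_pM2r xp) -(ler_pM2l c10).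
    have h := le_trans (ddec _ Nk) (dD _ Nk).
    have : C * D k * b k <= C * D k * x k.
      by rewrite ler_wpM2l ?(ltW bx)// mulr_ge0 ?D0// ltW.
    rewrite (_ : c1 * (2 * C / c1 * D k * x k) = 2 * (C * D k * x k)); last first.
      by field; rewrite gt_eqF.
    by have := ya k; lra.
  - by apply: bounded_sumsD => //; apply: bounded_sumsZ => //; rewrite divr_ge0 ?mulr_ge0 ?ltW.
split=> //.
apply: (@bounded_sums_le N _ (fun k => 4 * C * D' k + (a k * x k + a k * b k))).
- by move=> k; apply: addr_ge0; [exact: mulr_ge0 | exact: addr_ge0].
- move=> k Nk; rewrite /D' Nk.
  have h := le_trans (ddec _ Nk) (dD _ Nk).
  set p := 4 * C * D k; set q := a k * x k + a k * b k.
  have p0 : 0 <= p by rewrite mulr_ge0 ?D0.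
  have q0 : 0 <= q by rewrite addr_ge0.
  have y2 : y k ^+ 2 <= p * q.
    have : y k ^+ 2 / a k <= p * (x k + b k) by rewrite /p; have := caxy k; lra.
    rewrite ler_pdivrMr// => /le_trans; apply; rewrite /q; lra.
  have : y k ^+ 2 <= (p + q) ^+ 2.
    by apply: le_trans y2 _; have := sqr_ge0 p; have := sqr_ge0 q;
      have := mulr_ge0 p0 q0; lra.
  by rewrite ler_pXn2r ?nnegrE ?(addr_ge0 p0 q0).
- apply: bounded_sumsD; last exact: bounded_sumsD.
  exact: bounded_sumsZ.
Qed.

End RealSequences.

(** * Passage between extended and real series *)

Section ExtendedSeries.
Context {R : realType}.
Implicit Types (u a r : nat -> R).
Local Open Scope ereal_scope.

Lemma nneseries_bounded_sums u : (forall k, (0 <= u k)%R) ->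
  \sum_(0 <= k <oo) (u k)%:E < +oo -> bounded_sums u.
Proof.
move=> u0 uoo; have u0' k : 0 <= (u k)%:E by rewrite lee_fin.
have S0 : 0 <= \sum_(0 <= k <oo) (u k)%:E by exact: nneseries_ge0.
exists (fine (\sum_(0 <= k <oo) (u k)%:E)) => n.
rewrite -lee_fin fineK ?ge0_fin_numE// -sumEFin.
by apply: nneseries_lim_ge.
Qed.

Lemma bounded_sums_nneseries (e : nat -> \bar R) u : (forall k, 0 <= e k <= (u k)%:E) ->
  bounded_sums u -> \sum_(0 <= k <oo) e k < +oo.
Proof.
move=> eu [B hB]; apply: (@le_lt_trans _ _ B%:E); last exact: ltry.
apply: lime_le.
  by apply: is_cvg_nneseries => k _ _; case/andP: (eu k).
near=> n; apply: (@le_trans _ _ (\sum_(0 <= k < n) (u k)%:E)).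
  by apply: lee_sum => k _; case/andP: (eu k).
by rewrite sumEFin lee_fin.
Unshelve. all: by end_near. Qed.

(** Every tail is finite: an infinite tail at k would, since a_k > 0 and xi > 0, make the k-th term
    of the outer series infinite. The tails can therefore be taken as reals. *)
Lemma series_tail a r (xi : R) : (forall k, (0 < a k)%R) -> (forall k, (0 <= r k)%R) ->
  (0 < xi)%R ->
  \sum_(0 <= k <oo) (a k)%:E * (\sum_(k <= i <oo) (r i)%:E) `^ xi < +oo ->
  exists t : nat -> R,
    [/\ forall k, (0 <= t k)%R, forall k, t k = (t k.+1 + r k)%R, t @ \oo --> (0%R : R)
      & bounded_sums (fun k => a k * t k `^ xi)%R].
Proof.
move=> a0 r0 xi0; set T := fun k => \sum_(k <= i <oo) (r i)%:E => aT.
have r0' k : 0 <= (r k)%:E by rewrite lee_fin.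
have T0 k : 0 <= T k by exact: nneseries_ge0.
have aT0 k : 0 <= (a k)%:E * T k `^ xi by rewrite mule_ge0 ?poweR_ge0// lee_fin ltW.
have Tfin k : T k \is a fin_num.
  rewrite ge0_fin_numE//; case E : (T k) (T0 k) => [b||] // _; first exact: ltry.
  move: aT; rewrite ltNge => /negP []; apply: le_trans (nneseries_lim_ge k.+1 _); last by move=> i _ _; exact: aT0.
  rewrite big_nat_recr//=; rewrite -[leLHS]add0e; apply: leeD; first by apply: sume_ge0 => i _; exact: aT0.
  rewrite -/(T k) E poweRE gt_eqF//=.
  by rewrite gt0_muley// lte_fin.
exists (fun k => fine (T k)); split.
- by move=> k; exact: fine_ge0.
- move=> k; apply: EFin_inj; rewrite EFinD !fineK// /T.
  by rewrite (nneseries_split k 1)// addn1 big_nat1 addeC.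
- apply: fine_cvg; apply: (nneseries_tail_cvg (P := xpredT)) => //.
  by have := Tfin 0%N; rewrite ge0_fin_numE.
- apply: nneseries_bounded_sums.
    by move=> k; rewrite mulr_ge0 ?powR_ge0// ltW.
  move: aT; congr (_ < _); apply: eq_eseriesr => k _.
  by rewrite [in RHS]EFinM -poweR_EFin (fineK (Tfin k)).
Qed.

End ExtendedSeries.

Section KLBounds.
Context {R : realType}.

Lemma powRD_le2 (x y theta : R) : 0 <= x -> 0 <= y -> 0 < theta <= 1 ->
  (x + y) `^ theta <= 2 * (x `^ theta + y `^ theta).
Proof.
move=> x0 y0 /andP[t0 t1]; set z := Num.max x y.
have z0 : 0 <= z by rewrite le_max x0.
have h1 : (x + y) `^ theta <= (2 * z) `^ theta.
  apply: ge0_ler_powR; rewrite ?nnegrE ?addr_ge0 ?mulr_ge0 ?(ltW t0)//.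
  have : x <= z by rewrite le_max lexx.
  have : y <= z by rewrite le_max lexx orbT.
  lra.
apply: le_trans h1 _; rewrite powRM//.
have h2 : 2 `^ theta <= 2 :> R.
  by rewrite -[leRHS]powRr1//; apply: ler_powR => //; rewrite ler1n.
have h3 : z `^ theta <= x `^ theta + y `^ theta.
  by rewrite /z /Num.max; case: ifP => _; rewrite ?lerDl ?lerDr powR_ge0.
by apply: le_trans (ler_wpM2r (powR_ge0 _ _) h2) _; rewrite ler_wpM2l.
Qed.

(** Transfers the KL bound from [psi] to the corrected merit gap [delta]. The square is harmless
    because x <= 1 and theta >= 1/2 give x^(2 theta) <= x; the factor 4 comes from splitting a power
    of a sum twice. *)
Lemma KL_perturbed (theta c s c3 p x t delta : R) : 2^-1 <= theta < 1 ->
  0 <= c -> 0 <= s -> 0 <= c3 -> 0 <= x <= 1 -> 0 <= t -> 0 <= delta ->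
  `|p| `^ theta <= c * x -> delta = p + s * x ^+ 2 + c3 * t ->
  delta `^ theta <= 4 * (c + s `^ theta + c3 `^ theta) * (x + t `^ theta).
Proof.
move=> /andP[th2 th1] c0 s0 c30 /andP[x0 x1] t0 d0 px dE.
have th0 : 0 < theta by apply: lt_le_trans th2; rewrite invr_gt0.
have th : 0 < theta <= 1 by rewrite th0 ltW.
have sx0 : 0 <= s * x ^+ 2 by rewrite mulr_ge0// sqr_ge0.
have ct0 : 0 <= c3 * t by rewrite mulr_ge0.
have h1 : delta `^ theta <= (`|p| + s * x ^+ 2 + c3 * t) `^ theta.
  apply: ge0_ler_powR; rewrite ?nnegrE ?(ltW th0) ?addr_ge0//.
  by rewrite dE !lerD2r ler_norm.
have h2 := powRD_le2 (addr_ge0 (normr_ge0 p) sx0) ct0 th.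
have h3 := powRD_le2 (normr_ge0 p) sx0 th.
have h4 : (x ^+ 2) `^ theta <= x.
  have -> : x ^+ 2 = x `^ 2 by rewrite powR_mulrn.
  rewrite -powRrM; have [->|xn0] := eqVneq x 0.
    by rewrite powR0// gt_eqF// mulr_gt0.
  rewrite -[leRHS]powRr1//; apply: ger_powR; first by rewrite lt_def xn0 x0.
  by rewrite mulrC -ler_pdivrMr// div1r.
rewrite (powRM _ c30 t0) in h2; rewrite (powRM _ s0 (sqr_ge0 x)) in h3.
have S0 := powR_ge0 s theta; have C0 := powR_ge0 c3 theta; have T0 := powR_ge0 t theta.
have SX := ler_wpM2l S0 h4.
have := mulr_ge0 S0 T0; have := mulr_ge0 C0 x0; have := mulr_ge0 S0 x0.
have := mulr_ge0 C0 T0; have := mulr_ge0 c0 T0; have := mulr_ge0 c0 x0; lra.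
Qed.

End KLBounds.

(** * Merging the local KL inequalities by compactness *)

Section UniformKL.
Context {R : realType} {d : nat}.

Lemma bounded_fun_compact (w : nat -> 'rV[R]_d) : bounded_fun w ->
  exists2 K : set 'rV[R]_d, compact K & forall k, K (w k).
Proof.
(* [bounded_fun] only provides bounds strictly above [M], hence [M + 1]. *)
move=> [M [_ wM]]; have M1 : M < M + 1 by rewrite ltrDl.
have {}wM k : `|w k| <= M + 1 by exact: (wM _ M1 k I).
exists [set v : 'rV[R]_d | forall i, `[(- (M + 1)), (M + 1)]%classic (v ord0 i)].
  apply: (@rV_compact _ _ (fun=> `[(- (M + 1)), (M + 1)]%classic)) => _.
  exact: segment_compact.
move=> k i; rewrite /= in_itv/= -ler_norml; apply: le_trans (wM k).
by rewrite [leRHS]mx_normrE; apply: (le_bigmax _ (fun ij => `|w k ij.1 ij.2|) (ord0, i)).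
Qed.

(* Compactness merges the local KL data into one exponent and one constant: with
   exponent [1 - 1/(N+2)] and constant [N], the inequality at [w k], [k >= N],
   holds locally uniformly once [N] is large. *)
Lemma uniform_KL (w : nat -> 'rV[R]_d) (psi : 'rV[R]_d -> \bar R) (p x : nat -> R)
    (pstar theta0 : R) :
  bounded_fun w ->
  (forall v, v \in cluster (w @ \oo) -> KL_property psi v /\ psi v = pstar%:E) ->
  (forall k, psi (w k) = (p k)%:E) -> p @ \oo --> pstar ->
  (forall k, 0 <= x k) -> (forall k, (dist0 (subdiff psi (w k)) <= (x k)%:E)%E) ->
  theta0 < 1 ->
  exists theta c N, [/\ theta0 < theta, 2^-1 <= theta < 1, 0 < c &
    forall k, (N <= k)%N -> `|p k - pstar| `^ theta <= c * x k].
Proof.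
move=> wb KL pw pcvg x0 dx th01; have [K Kc wK] := bounded_fun_compact wb.
pose th (N : nat) : R := 1 - N.+2%:R^-1.
have thlim (e : R) : e < 1 -> \forall N \near \oo, e < th N.
  move=> e1; rewrite -subr_gt0 in e1; near=> N.
  rewrite /th ltrBrDl -ltrBrDr.
  rewrite -[ltRHS]invrK ltf_pV2 ?posrE ?ltr0n ?invr_gt0//.
  have : (1 - e)^-1 < N%:R by near: N; exact: nbhs_infty_gtr.
  by move/lt_le_trans; apply; rewrite ler_nat ltnW.
(* Stated for points v rather than indices so that compactness applies; points that are no late
   iterate satisfy it vacuously. *)
pose P N v := forall k, (N <= k)%N -> w k = v -> `|p k - pstar| `^ th N <= N%:R * x k.
have near_cover : \forall N \near \oo, K `<=` P N.
  apply: (proj1 (compact_near_coveringP K) Kc) => v Kv.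
  (* Near a point that is not an accumulation point there are no late iterates. *)
  have [vcl|] := boolP (v \in cluster (w @ \oo)); last first.
    rewrite notin_setE /cluster /meets /= => /existsNP[A /existsNP[B]].
    move=> /not_implyP[FA /not_implyP[vB /set0P/negP/negPn/eqP AB]].
    have [N0 _ N0A] := FA.
    near=> v' N => k /= Nk wk.
    suff : (A `&` B) v' by rewrite AB.
    split; last by near: v'.
    rewrite -wk; apply: N0A => /=.
    by apply: leq_trans Nk; near: N; exact: nbhs_infty_ge.
  have [[_ [theta [c [eta [U [thetaB c0 eta0 vU KLU]]]]]] psiv] := KL v vcl.
  have /andP[theta_ge0 theta1] := thetaB.
  have [e e0 eeta] : exists2 e : R, 0 < e & (e%:E <= eta)%E.
    move: eta0; case: (eta) => [b||] //; last by exists 1; rewrite ?leey.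
    by rewrite lte_fin => b0; exists b.
  have /cvgrPdist_lt pc := pcvg.
  have [Ne _ pe] := pc e e0; have [N1 _ p1] := pc 1 ltr01.
  near=> v' N => k /= Nk wk.
  have pke : `|p k - pstar| < e.
    rewrite distrC; apply: pe => /=.
    by apply: leq_trans Nk; near: N; exact: nbhs_infty_ge.
  have pk1 : `|p k - pstar| < 1.
    rewrite distrC; apply: p1 => /=.
    by apply: leq_trans Nk; near: N; exact: nbhs_infty_ge.
  (* KL is silent at zero gap, but the left side is then 0 because the exponent [th N] is
     nonzero. *)
  have [->|pk0] := eqVneq `|p k - pstar| 0.
    rewrite powR0 ?mulr_ge0//.
    by rewrite /th subr_eq0 eq_sym invr_eq1 (eqr_nat R _ 1).
  have pkp : 0 < `|p k - pstar| by rewrite lt_def pk0 normr_ge0.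
  apply: (@le_trans _ _ (`|p k - pstar| `^ theta)).
    apply: ger_powR; first by rewrite pkp ltW.
    by apply: ltW; near: N; exact: thlim.
  have := KLU v'; rewrite -wk pw psiv -EFinB abse_EFin !lte_fin pkp.
  move=> /(_ _ _)/le_trans h.
  rewrite -lee_fin -poweR_EFin; apply: h.
  - by rewrite wk; near: v'.
  - by apply: lt_le_trans eeta; rewrite lte_fin.
  rewrite EFinM; apply: (@le_trans _ _ (c%:E * (x k)%:E)%E).
    by rewrite lee_wpmul2l// lee_fin ltW.
  rewrite -!EFinM lee_fin ler_wpM2r// ltW//.
  by near: N; exact: nbhs_infty_gtr.
near \oo => N.
exists (th N), N%:R, N; split.
- by near: N; exact: thlim.
- rewrite ltrBlDr ltrDl invr_gt0 ltr0n andbT /th lerBrDl.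
  have : N.+2%:R^-1 <= 2^-1 :> R by rewrite lef_pV2 ?posrE ?ltr0n// ler_nat.
  by move: (N.+2%:R^-1) => y; lra.
- by rewrite ltr0n; near: N; exact: nbhs_infty_gt.
- move=> k Nk; have : K `<=` P N by near: N.
  by move=> /(_ (w k) (wK k)); exact.
Unshelve. all: by end_near. Qed.

End UniformKL.

(** * Limits of the iterates *)

Section Limits.
Context {R : realType} {d : nat}.
Implicit Types (w v : nat -> 'rV[R]_d) (phi : 'rV[R]_d -> \bar R).

Lemma cvg_dotv w v (wl vl : 'rV[R]_d) : w @ \oo --> wl -> v @ \oo --> vl ->
  (fun k => dotv (w k) (v k)) @ \oo --> dotv wl vl.
Proof.
move=> wc vc; apply: cvg_big => [|j _]; first exact: add_continuous.
have coord u (ul : 'rV[R]_d) : u @ \oo --> ul -> (fun k => u k 0 j) @ \oo --> ul 0 j.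
  by move=> uc; exact: (cvg_comp _ _ uc (@coord_continuous R 1 d 0 j ul)).
by apply: cvgM; exact: coord.
Qed.

Lemma cvg_cluster_seq w (wl : 'rV[R]_d) : w @ \oo --> wl -> wl \in cluster (w @ \oo).
Proof.
move=> wc; rewrite inE => A B wA wlB.
have wB : (w @ \oo) B by exact: wc.
have [k [Ak Bk]] := @filter_ex nat \oo _ (w @^-1` A `&` w @^-1` B) (filterI wA wB).
by exists (w k).
Qed.

(** Boundedness provides an accumulation point; from an iterate close to it and late enough, the
    remaining path length is too short to leave its neighbourhood. *)
Lemma summable_steps_cvg w : bounded_fun w ->
  bounded_sums (fun k => enorm (w k.+1 - w k)) ->
  exists wl : 'rV[R]_d, w @ \oo --> wl.
Proof.
move=> wb [B hB]; have [K Kc wK] := bounded_fun_compact wb.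
have [|wl [_ wl_cl]] := Kc (w @ \oo) _; first by exists 0%N => // k _; exact: wK.
exists wl; apply: enorm_cvg => e e0.
pose S n := \sum_(0 <= i < n) enorm (w i.+1 - w i).
have wS i j : (i <= j)%N -> enorm (w j - w i) <= S j - S i.
  move=> ij; rewrite -(subnKC ij); elim: (j - i)%N => [|p IH].
    by rewrite addn0 !subrr enorm0.
  rewrite addnS [S (_ + p).+1]/S big_nat_recr//= -/(S _) addrAC.
  apply: le_trans (ler_enormB_trans (w (i + p)%N) _ _) _.
  by rewrite addrC lerD.
have [||l Sl lS] := @near_antitone_cvg R 0 (fun n => - S n) (- B).
- by move=> k _; rewrite lerN2 /S big_nat_recr//= lerDl enorm_ge0.
- by move=> k _; rewrite lerN2; exact: hB.
have e20 : 0 < e / 2 by rewrite divr_gt0.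
have : \forall n \near \oo, - S n < l + e / 2.
  by apply: (cvgr_lt _ Sl); rewrite ltrDl.
move=> [N _ SN].
have [_ [[i /= Ni <-] wiwl]] :=
  wl_cl [set w i | i in [set i | (N <= i)%N]] [set v | enorm (v - wl) < e / 2]
    (ex_intro2 _ _ N I (fun i Ni => ex_intro2 _ _ i Ni erefl)) (nbhs_enorm wl e20).
exists i => // j /= ij; apply: le_lt_trans (ler_enormB_trans (w i) _ _) _.
have := wS _ _ ij; have := SN i Ni; have := lS j isT; move: wiwl => /=; lra.
Qed.

(** Lower semicontinuity bounds phi(wl) above by nearby phi(w_k), up to e. For the reverse bound,
    the weak subgradient inequality at w_k is tested at wl, where the bound on v_k makes the linear
    term small. *)
Lemma cluster_value (h : 'rV[R]_d -> R) phi rho w v (wl : 'rV[R]_d) (V l : R) :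
  0 <= rho -> {for wl, continuous h} -> lower_semicontinuous phi -> eproper phi ->
  (forall k, weak_subgradient rho phi (w k) (v k)) ->
  (\forall k \near \oo, enorm (v k) <= V) ->
  (fun k => h (w k) + fine (phi (w k))) @ \oo --> l ->
  wl \in cluster (w @ \oo) -> edom phi wl ->
  ((h wl)%:E + phi wl)%E = l%:E.
Proof.
move=> rho0 hc lsc pp wv vV lc /set_mem wl_cl wld.
have wlfin := eproper_fin_num pp wld.
(* Three errors e come from continuity of [h], semicontinuity and the limit; |V| and [rho] pay for
   the linear and quadratic parts of the subgradient inequality. Taking the radius at most 1 bounds
   the squared distance by e too. *)
have key e : 0 < e -> `|h wl + fine (phi wl) - l| <= e * (3 + `|V| + rho).
  move=> e0; pose s := Num.min e 1.
  have s0 : 0 < s by rewrite lt_min e0 ltr01.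
  have se : s <= e by rewrite ge_min lexx.
  have s1 : s <= 1 by rewrite ge_min lexx orbT.
  have [U wlU Uphi] : exists2 U, nbhs wl U & forall y, U y ->
      ((fine (phi wl) - e)%:E < phi y)%E.
    by apply: lsc; rewrite -[ltRHS](fineK wlfin) lte_fin ltrBlDr ltrDl.
  have [N _ NP] : \forall k \near \oo, enorm (v k) <= V /\
      `|l - (h (w k) + fine (phi (w k)))| < e.
    by apply: filterI => //; exact: (proj1 (cvgrPdist_lt _ _) lc).
  have hnear : \forall y \near wl, `|h wl - h y| < e.
    exact: (proj1 (cvgrPdist_lt _ _) hc).
  have [_ [[k /= Nk <-] [wkU [hk wks]]]] :=
    wl_cl [set w i | i in [set i | (N <= i)%N]] _
    (ex_intro2 _ _ N I (fun i Ni => ex_intro2 _ _ i Ni erefl))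
    (filterI wlU (filterI hnear (nbhs_enorm wl s0))).
  have [vkV lk] := NP k Nk; have [wkfin _] := wv k.
  have h1 := Uphi _ wkU; rewrite -(fineK wkfin) lte_fin in h1.
  have h2 := weak_subgradient_le (wv k) wlfin.
  rewrite enormB in wks; set n := enorm (wl - w k) in wks.
  have n0 : 0 <= n := enorm_ge0 _.
  have h3 : - (`|V| * e) <= dotv (v k) (wl - w k).
    rewrite lerNl -dotvNl; apply: le_trans (dotv_le_enorm _ _) _; rewrite enormN.
    apply: ler_pM; rewrite ?enorm_ge0//.
      by apply: le_trans vkV _; exact: ler_norm.
    by apply: le_trans se; exact: ltW.
  have h4 : rho / 2 * n ^+ 2 <= rho * e.
    have : n ^+ 2 <= 1 * e.
      by rewrite expr2; apply: ler_pM => //; [exact: le_trans (ltW wks) s1|exact: le_trans (ltW wks) se].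
    move=> /(ler_wpM2l rho0).
    have := mulr_ge0 rho0 (ltW e0); lra.
  rewrite -/n in h2.
  have r1 := mulr_ge0 (ltW e0) rho0; have r2 := mulr_ge0 (ltW e0) (normr_ge0 V).
  move: hk lk; rewrite ler_norml !ltr_norml => /andP[? ?] /andP[? ?].
  by apply/andP; split; lra.
have c0 : 0 < 3 + `|V| + rho by rewrite ltr_wpDr// ltr_wpDr.
rewrite -(fineK wlfin) -EFinD; congr EFin.
apply/eqP; rewrite -subr_eq0 -normr_le0; apply/ler_addgt0Pl => e e0.
rewrite addr0; apply: le_trans (key (e / (3 + `|V| + rho)) _) _.
  by rewrite divr_gt0.
by rewrite divfK// gt_eqF.
Qed.

(** Closedness of the graph: in the inequality tested at a fixed y all terms converge except
    phi(w_k), which sits on the side where lower semicontinuity suffices. *)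
Lemma weak_subgradient_limit phi rho w v (wl vl : 'rV[R]_d) :
  lower_semicontinuous phi -> eproper phi ->
  (forall k, weak_subgradient rho phi (w k) (v k)) ->
  w @ \oo --> wl -> v @ \oo --> vl -> edom phi wl -> weak_subgradient rho phi wl vl.
Proof.
move=> lsc pp wv wc vc wld; have wlfin := eproper_fin_num pp wld.
split=> // y.
have [yd|] := boolP (phi y < +oo)%E; last by rewrite -leNgt leye_eq => /eqP ->; rewrite leey.
have yfin := eproper_fin_num pp yd.
rewrite -(fineK wlfin) -(fineK yfin) -EFinD lee_fin.
pose g k := dotv (v k) (y - w k) - rho / 2 * enorm (y - w k) ^+ 2.
have gc : g @ \oo --> dotv vl (y - wl) - rho / 2 * enorm (y - wl) ^+ 2.
  have ywc : (fun k => y - w k) @ \oo --> y - wl.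
    by apply: (@cvgB _ _ _ \oo _ (cst y)) => //; exact: cvg_cst.
  apply: cvgB; first exact: cvg_dotv.
  apply: cvgM; first exact: cvg_cst.
  rewrite sqr_enorm; under eq_fun do rewrite sqr_enorm.
  exact: cvg_dotv.
apply/ler_addgt0Pr => e e0; have e20 : 0 < e / 2 by rewrite divr_gt0.
have [U wlU Uphi] : exists2 U, nbhs wl U & forall y, U y ->
    ((fine (phi wl) - e / 2)%:E < phi y)%E.
  by apply: lsc; rewrite -[ltRHS](fineK wlfin) lte_fin ltrBlDr ltrDl.
have /cvgrPdist_lt/(_ _ e20) gn := gc.
have wU : \forall k \near \oo, U (w k) by exact: wc.
have [k [/= wkU gk]] := filter_ex (filterI wU gn).
have [wkfin _] := wv k.
have h1 := Uphi _ wkU; rewrite -(fineK wkfin) lte_fin in h1.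
have := weak_subgradient_le (wv k) yfin; move: gk; rewrite ltr_norml => /andP[_].
rewrite /g; lra.
Qed.

End Limits.

(** * One outer iteration as a perturbed normal map step *)

Section OuterStep.
Context {R : realType} {d n : nat}.
Variables (f : 'I_n -> 'rV[R]_d -> R) (phi : 'rV[R]_d -> \bar R).
Variables (L rho lambda : R).
Hypotheses (n_gt0 : (0 < n)%N) (f_diff : forall i (x : 'rV[R]_d), differentiable (f i) x).
Hypothesis L_gt0 : 0 < L.
Hypothesis f_lip : forall i x y, x \in edom phi -> y \in edom phi ->
  enorm (grad (f i) x - grad (f i) y) <= L * enorm (x - y).
Hypotheses (phi_wcvx : weakly_convex rho phi) (phi_proper : eproper phi).
Hypotheses (lambda_gt0 : 0 < lambda) (lambda_rho : 2 * (lambda * rho) <= 1).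

Lemma favg_diff x : differentiable (favg f) x.
Proof. exact: differentiable_favg. Qed.

Lemma scale_sum_le (B : R) (F : 'I_n -> 'rV[R]_d) : (forall i, enorm (F i) <= B) ->
  enorm (n%:R^-1 *: \sum_(i < n) F i) <= B.
Proof.
move=> FB; rewrite enormZ ger0_norm ?invr_ge0// mulrC ler_pdivrMr ?ltr0n//.
apply: le_trans (ler_enorm_sum _ _ _) _.
apply: (@le_trans _ _ (\sum_(i < n) B)); first exact: ler_sum.
by rewrite sumr_const card_ord mulr_natr.
Qed.

Lemma grad_favg_lip x y : edom phi x -> edom phi y ->
  enorm (grad (favg f) x - grad (favg f) y) <= L * enorm (x - y).
Proof.
move=> xd yd; rewrite !grad_favg// -scalerBr -sumrB; apply: scale_sum_le => i.
by apply: f_lip; exact: mem_set.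
Qed.

Lemma prox_edom z w : w \in prox lambda phi z -> edom phi w.
Proof.
move=> /(prox_weak_subgradient phi_proper phi_wcvx lambda_gt0) [wfin _].
by rewrite /edom /= ltey; move: wfin; rewrite fin_numE => /andP[].
Qed.

Lemma bounded_grad w : bounded_fun w -> (forall k, edom phi (w k)) ->
  exists2 G : R, 0 <= G &
    forall (k : nat), enorm (grad (favg f) (w k)) <= G /\
      forall i, enorm (grad (f i) (w k)) <= G.
Proof.
move=> [M [_ wM]] wd; have M1 : M < M + 1 by rewrite ltrDl.
have {}wM k : enorm (w k) <= d.+1%:R * (M + 1).
  by apply: le_trans (enorm_le_normr _) _; rewrite ler_wpM2l//; exact: (wM _ M1 k I).
set B := d.+1%:R * (M + 1) in wM.
have B0 : 0 <= B by exact: le_trans (enorm_ge0 _) (wM 0%N).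
pose G := \sum_(i < n) enorm (grad (f i) (w 0%N)) + L * (B + B).
have G0 : 0 <= G.
  rewrite addr_ge0 ?mulr_ge0 ?addr_ge0 ?(ltW L_gt0)//.
  by apply: sumr_ge0 => i _; exact: enorm_ge0.
have fG k i : enorm (grad (f i) (w k)) <= G.
  rewrite -(subrK (grad (f i) (w 0%N)) (grad (f i) (w k))).
  apply: le_trans (ler_enormD _ _) _; rewrite addrC /G; apply: lerD.
    by rewrite (bigD1 i)//= lerDl; apply: sumr_ge0 => j _; exact: enorm_ge0.
  apply: le_trans (f_lip _ (mem_set (wd k)) (mem_set (wd 0%N))) _.
  apply: ler_wpM2l; first exact: ltW.
  by apply: le_trans (ler_enormD _ _) _; rewrite enormN lerD.
by exists G => // k; split=> //; rewrite grad_favg//; exact: scale_sum_le.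
Qed.

Lemma outer_step (alpha : nat -> R) (sigma : nat -> 'S_n) (z w : nat -> 'rV[R]_d) :
  bounded_fun w -> (forall k, 0 < alpha k) ->
  norm_PRR f phi lambda alpha sigma z w ->
  (forall k, w k \in prox lambda phi (z k)) /\
  exists K M : R, [/\ 0 <= K, 0 <= M & forall k, 2 * K * (n%:R * alpha k) <= 1 ->
    exists2 e, z k.+1 = z k - (n%:R * alpha k) *: normal_map (favg f) lambda (z k) (w k) + e &
      enorm e <= M * (n%:R * alpha k) ^+ 2 *
        (enorm (normal_map (favg f) lambda (z k) (w k)) + 1)].
Proof.
move=> wb a0 [wz0 zw].
have wz k : w k \in prox lambda phi (z k).
  case: k => [//|k]; have [zi [wi [_ st [-> ->]]]] := zw k.
  (* The last inner step, i = n - 1, exists because n > 0. *)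
  by have [_] := st (Ordinal (etrans (ltn_predL n) n_gt0)); rewrite /= prednK.
split=> //.
have [G G0 wG] := bounded_grad wb (fun k => prox_edom (wz k)).
have lr2 : 1 <= 2 * (1 - lambda * rho) by move: lambda_rho; lra.
have m0 : 0 < lambda^-1 by rewrite invr_gt0.
(* As 1 - lambda rho >= 1/2, the prox is 2-Lipschitz: the gradient moves by 2L, and (z - w)/lambda
   by (1 + 2)/lambda, per unit of change of [z]. *)
pose K := 2 * L + 3 * lambda^-1.
have K0 : 0 <= K by rewrite addr_ge0 ?mulr_ge0 ?(ltW L_gt0) ?(ltW m0).
exists K, (2 * K * (2 * G + 1)); split=> //.
  by rewrite mulr_ge0 ?mulr_ge0// addr_ge0// mulr_ge0.
move=> k small; have [zi [wi [[zi0 wi0] st [-> _]]]] := zw k.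
have wizi i : (i <= n)%N -> wi i \in prox lambda phi (zi i).
  case: i => [_|i i_n]; first by rewrite wi0 zi0.
  by have [_] := st (Ordinal i_n).
set F := normal_map _ _ _ _.
pose q (i : 'I_n) := grad (f (sigma k i)) (wi i) + lambda^-1 *: (zi i - wi i).
pose q0 (i : 'I_n) := grad (f (sigma k i)) (w k) + lambda^-1 *: (z k - w k).
have qq0 i : enorm (q i - q0 i) <= K * enorm (zi i - zi 0%N).
  have iz : wi i \in prox lambda phi (zi i) by apply: wizi; exact: ltnW.
  have wl : enorm (wi i - w k) <= 2 * enorm (zi i - z k).
    have := prox_lip phi_proper phi_wcvx lambda_gt0 iz (wz k).
    have := ler_wpM2r (enorm_ge0 (wi i - w k)) lr2; lra.
  have gl := f_lip (sigma k i) (mem_set (prox_edom iz)) (mem_set (prox_edom (wz k))).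
  have -> : q i - q0 i = (grad (f (sigma k i)) (wi i) - grad (f (sigma k i)) (w k)) +
      (lambda^-1 *: (zi i - z k) - lambda^-1 *: (wi i - w k)).
    by apply/rowP => j; rewrite !mxE; ring.
  apply: le_trans (ler_enormD _ _) _.
  have := ler_enormD (lambda^-1 *: (zi i - z k)) (- (lambda^-1 *: (wi i - w k))).
  rewrite enormN !enormZ gtr0_norm// zi0 /K.
  have := ler_wpM2l (ltW m0) wl; have := ler_wpM2l (ltW L_gt0) wl. lra.
have nn0 : n%:R != 0 :> R by rewrite pnatr_eq0 -lt0n.
have q0F : \sum_(i < n) q0 i = n%:R *: F.
  rewrite big_split /= sumr_const card_ord.
  rewrite -(reindex_inj (h := sigma k) (@perm_inj _ (sigma k))
    (F := fun i => grad (f i) (w k)) (P := xpredT))/=.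
  rewrite /F /normal_map grad_favg// [RHS]scalerDr scalerA divff// scale1r.
  by rewrite -[in LHS]scaler_nat.
have q0B i : enorm (q0 i) <= enorm F + 2 * G.
  have -> : q0 i = F + (grad (f (sigma k i)) (w k) - grad (favg f) (w k)).
    by rewrite /F /normal_map /q0; apply/rowP => j; rewrite !mxE; ring.
  apply: le_trans (ler_enormD _ _) _; rewrite lerD2l.
  apply: le_trans (ler_enormD _ _) _; rewrite enormN.
  by have [h /(_ (sigma k i))] := wG k; lra.
have F0 := enorm_ge0 F.
have A0 : 0 <= enorm F + 2 * G by rewrite addr_ge0// mulr_ge0.
have := @inner_loop_error R d n (alpha k) K _ zi q q0 (ltW (a0 k)) K0 A0 small
  (fun i => proj1 (st i)) qq0 q0B.
rewrite q0F zi0 scalerA (mulrC (alpha k)) => err.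
exists (zi n - z k + (n%:R * alpha k) *: F).
  by apply/rowP => j; rewrite !mxE; ring.
apply: le_trans err _; set a2 := (_ * alpha k) ^+ 2.
have a20 : 0 <= a2 by exact: sqr_ge0.
have Ka2 := mulr_ge0 K0 a20.
have := mulr_ge0 Ka2 (mulr_ge0 G0 F0); have := mulr_ge0 Ka2 G0.
have := mulr_ge0 Ka2 F0; lra.
Qed.

End OuterStep.

(** * Assembly of the convergence proof *)

Theorem theorem21 (R : realType) (d n : nat) (n_gt0 : (0 < n)%N)
  (f : 'I_n -> 'rV[R]_d -> R) (phi : 'rV[R]_d -> \bar R)
  (L rho lambda flb philb : R) (alpha : nat -> R) (sigma : nat -> 'S_n)
  (z w : nat -> 'rV[R]_d)
  (f_diff : forall i (x : 'rV[R]_d), differentiable (f i) x)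
  (L_gt0 : 0 < L)
  (f_lip : forall i x y, x \in edom phi -> y \in edom phi ->
     enorm (grad (f i) x - grad (f i) y) <= L * enorm (x - y))
  (rho_gt0 : 0 < rho)
  (phi_wcvx : weakly_convex rho phi)
  (phi_lsc : lower_semicontinuous phi)
  (phi_proper : eproper phi)
  (f_lb : forall i x, x \in edom phi -> flb <= f i x)
  (phi_lb : forall x, x \in edom phi -> (philb%:E <= phi x)%E)
  (lambda_itv : 0 < lambda < (4 * rho)^-1)
  (zw_gen : norm_PRR f phi lambda alpha sigma z w)
  (alpha_itv : forall k, 0 < alpha k <= alpha_bar L lambda rho / n%:R)
  (alpha_sum : (\sum_(0 <= k <oo) (alpha k)%:E = +oo)%E)
  (alpha_tail : exists xi : R, 0 < xi < 1 /\
     (\sum_(0 <= k <oo)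
        (alpha k)%:E * (\sum_(k <= i <oo) (alpha i ^+ 3)%:E) `^ xi < +oo)%E)
  (w_bounded : bounded_fun w)
  (psi_KL : forall wbar, wbar \in cluster (w @ \oo) ->
     KL_property (psi_of f phi) wbar) :
  [/\ (\sum_(0 <= k <oo)
         (alpha k)%:E * dist0 (subdiff (psi_of f phi) (w k)) < +oo)%E,
      (\sum_(0 <= k <oo) (enorm (w k.+1 - w k))%:E < +oo)%E
    & exists wstar : 'rV[R]_d,
        w @ \oo --> wstar /\ 0 \in subdiff (psi_of f phi) wstar].
Proof.
have /andP[l0 l4] := lambda_itv.
have a0 k : 0 < alpha k by case/andP: (alpha_itv k).
have lr : 4 * (lambda * rho) <= 1.
  have := ltW l4; rewrite -(ler_pM2r (mulr_gt0 (ltr0n _ 4) rho_gt0)).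
  rewrite mulVf ?gt_eqF ?mulr_gt0//; lra.
have lr2 : 2 * (lambda * rho) <= 1.
  by have := mulr_gt0 l0 rho_gt0; lra.
have np : 0 < n%:R :> R by rewrite ltr0n.
have h_diff := favg_diff f_diff.
have h_lip := grad_favg_lip n_gt0 f_diff f_lip.
have [wz [K [M [K0 M0 step]]]] :=
  outer_step n_gt0 f_diff L_gt0 f_lip phi_wcvx phi_proper l0 lr2 w_bounded a0 zw_gen.
have wd k : edom phi (w k) by exact: (prox_edom phi_wcvx phi_proper l0 (wz k)).
have [G G0 wG] := bounded_grad n_gt0 f_diff L_gt0 f_lip w_bounded wd.
have [xi [/andP[xi0 xi1] tail]] := alpha_tail.
have r0 k : 0 <= alpha k ^+ 3 by rewrite exprn_ge0// ltW.
have [t [t0 tS tc tB]] := series_tail a0 r0 xi0 tail.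
pose a k := n%:R * alpha k.
have a_gt0 k : 0 < a k by rewrite mulr_gt0.
have a_small e : 0 < e -> \forall k \near \oo, a k <= e.
  move=> e0; have en0 : 0 < (e / n%:R) ^+ 3 by rewrite exprn_gt0// divr_gt0.
  near=> k; have : t k < (e / n%:R) ^+ 3.
    by near: k; exact: (cvgr_lt _ tc).
  have := t0 k.+1; rewrite (tS k) => h1 h2.
  have : alpha k ^+ 3 <= (e / n%:R) ^+ 3 by lra.
  rewrite ler_pXn2r// ?nnegrE ?divr_ge0 ?(ltW (a0 k)) ?(ltW e0)//.
  by rewrite ler_pdivlMr// mulrC.
pose x k := enorm (normal_map (favg f) lambda (z k) (w k)).
pose y k := enorm (w k.+1 - w k).
pose psi k := favg f (w k) + fine (phi (w k)).
have x_ge0 k : 0 <= x k by exact: enorm_ge0.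
have wfin k : phi (w k) \is a fin_num by exact: eproper_fin_num.
have psi_lb k : flb + philb <= psi k.
  apply: lerD.
    rewrite /favg mulrC ler_pdivlMr// mulr_natr -[X in _ *+ X]card_ord -sumr_const.
    by apply: ler_sum => i _; apply: f_lb; exact: mem_set.
  by rewrite -lee_fin fineK//; apply: phi_lb; exact: mem_set.
pose q := 1 + (lambda * L) ^+ 2.
have q1 : 1 <= q by rewrite lerDl sqr_ge0.
have q0 : 0 < q by exact: lt_le_trans q1.
(* [tau1] is the largest weight the descent estimate allows; [tau2] is the second weight needed to
   separate |F|^2 from [psi]. *)
pose tau1 := (4 * q)^-1; pose tau2 := tau1 / 2.
have tau10 : 0 < tau1 by rewrite invr_gt0 mulr_gt0.
have tau1q : 4 * (tau1 * q) <= 1.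
  by rewrite /tau1 mulrCA mulVf// gt_eqF// mulr_gt0.
pose c3 := 14 * M ^+ 2 * n%:R ^+ 3.
have c30 : 0 <= c3 by rewrite !mulr_ge0 ?sqr_ge0 ?exprn_ge0.
pose K2 := lambda^-1 + (L + rho) / 2 + 3 / 2 * (lambda * (L + lambda^-1) ^+ 2).
have K20 : 0 < K2.
  by rewrite addr_gt0 ?addr_gt0 ?mulr_gt0 ?exprn_gt0 ?addr_gt0 ?invr_gt0 ?divr_gt0 ?addr_gt0.
have desc tau : 0 < tau -> 4 * (tau * q) <= 1 -> exists N,
    descends N a x y (fun k => alpha k ^+ 3) psi (tau * lambda / 2) (tau / 8) c3.
  move=> tau0 tauq.
  have : \forall k \near \oo, [/\ 2 * K * a k <= 1, a k * K2 <= tau / 8 &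
      14 * (M * a k) ^+ 2 <= tau / 8].
    have e1 : 0 < (2 * K + 1)^-1 by rewrite invr_gt0 ltr_wpDl// mulr_ge0.
    have e2 : 0 < tau / 8 / K2 by rewrite divr_gt0// divr_gt0.
    have e3 : 0 < tau / 8 / (14 * M ^+ 2 + 1).
      by rewrite divr_gt0 ?divr_gt0// ltr_wpDl// mulr_ge0// sqr_ge0.
    near=> k; have ak1 : a k <= 1 by near: k; exact: a_small.
    have ak0 := a_gt0 k; split.
    - have : a k <= (2 * K + 1)^-1 by near: k; exact: a_small.
      rewrite -[_^-1]mul1r ler_pdivlMr; last by rewrite ltr_wpDl// mulr_ge0.
      by lra.
    - by rewrite -ler_pdivlMr//; near: k; exact: a_small.
    - have : a k <= tau / 8 / (14 * M ^+ 2 + 1) by near: k; exact: a_small.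
      rewrite ler_pdivlMr; last by rewrite ltr_wpDl// mulr_ge0// sqr_ge0.
      have : a k * a k <= 1 * a k by rewrite ler_wpM2r// ltW.
      move/(ler_wpM2l (sqr_ge0 M)); rewrite exprMn; lra.
  move=> [N _ NP]; exists N => k Nk; have [s1 s2 s3] := NP k Nk.
  have [e zE eM] := step k s1.
  have := merit_descent h_diff L_gt0 h_lip rho_gt0 phi_wcvx phi_proper l0 lr (wz k)
    (wz k.+1) zE eM (a_gt0 k) tau0 tauq s2 s3.
  rewrite /merit -/(x k) -/(x k.+1) -/(psi k) -/(psi k.+1) -/(y k) -/(a k).
  have E : 14 * M ^+ 2 * a k ^+ 3 = c3 * alpha k ^+ 3 by rewrite /c3 /a; ring.
  by rewrite E.
have [N1 d1] := desc _ tau10 tau1q.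
have [||N2 d2] := desc tau2.
- by rewrite divr_gt0.
- by rewrite /tau2; have := mulr_gt0 tau10 q0; lra.
have aoo : ~ bounded_sums a.
  move=> /(@bounded_sumsZ _ n%:R^-1 _); rewrite invr_ge0 ler0n => /(_ isT) aB.
  suff : (\sum_(0 <= k <oo) (alpha k)%:E < +oo)%E by rewrite alpha_sum.
  apply: bounded_sums_nneseries aB => k.
  by rewrite !lee_fin mulKf ?gt_eqF// lexx ltW.
pose N := maxn N1 N2.
have dN1 : descends N a x y (fun k => alpha k ^+ 3) psi (tau1 * lambda / 2) (tau1 / 8) c3.
  by move=> k Nk; apply: d1; exact: leq_trans (leq_maxl _ _) Nk.
have dN2 : descends N a x y (fun k => alpha k ^+ 3) psi (tau2 * lambda / 2) (tau2 / 8) c3.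
  by move=> k Nk; apply: d2; exact: leq_trans (leq_maxr _ _) Nk.
have tau1l : 0 < tau1 * lambda by rewrite mulr_gt0.
have [|||xc [l psic]] := two_weights_cvg a_gt0 t0 tS tc psi_lb aoo _ _ _ c30 dN2 dN1.
- by rewrite /tau2; apply/andP; split; lra.
- by rewrite /tau2; lra.
- by lra.
have sg k : weak_subgradient rho phi (w k) (lambda^-1 *: (z k - w k)).
  exact: prox_weak_subgradient (wz k).
have psi_cl v : v \in cluster (w @ \oo) ->
    KL_property (psi_of f phi) v /\ psi_of f phi v = l%:E.
  move=> vcl; have KLv := psi_KL v vcl; split=> //.
  have vd : edom phi v.
    have [/set_mem + _] := KLv; rewrite /edom /psi_of /=.
    by case: (phi v) => // *; exact: ltry.
  (* The weak subgradient is F_k minus the gradient of the average: the latter is bounded by [G],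
     and |F_k| <= 1 eventually. *)
  apply: (cluster_value (V := G + 1) (ltW rho_gt0) _ phi_lsc phi_proper sg _ psic vcl vd).
    by apply: differentiable_continuous; exact: h_diff.
  near=> k.
  have -> : lambda^-1 *: (z k - w k) =
      normal_map (favg f) lambda (z k) (w k) - grad (favg f) (w k).
    by rewrite /normal_map addrAC subrr add0r.
  apply: le_trans (ler_enormD _ _) _; rewrite enormN addrC; apply: lerD.
    by have [] := wG k.
  by near: k; exact: (cvgr_le _ xc).
have psi_w k : psi_of f phi (w k) = (psi k)%:E by rewrite /psi_of -[phi _]fineK.
have distx k : (dist0 (subdiff (psi_of f phi) (w k)) <= (x k)%:E)%E.
  apply: ereal_inf_lbound; exists (normal_map (favg f) lambda (z k) (w k)) => //.
  exact: (normal_map_subdiff h_diff rho_gt0 phi_wcvx phi_proper l0 (wz k)).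
(* The exponent is requested above [xi], so that t_k^theta <= t_k^xi once t_k <= 1. *)
have [theta [c [N3 [xith th2 cp KL]]]] :=
  uniform_KL w_bounded psi_cl psi_w psic x_ge0 distx xi1.
have theta0 : 0 < theta by exact: lt_trans xith.
have theta01 : 0 < theta < 1 by rewrite theta0; case/andP: th2.
pose s := tau1 * lambda / 2; pose delta k := psi k + s * x k ^+ 2 + c3 * t k - l.
have s0 : 0 <= s by rewrite divr_ge0// ltW.
have deltac : delta @ \oo --> 0.
  have -> : 0 = l + s * 0 ^+ 2 + c3 * 0 - l :> R by ring.
  apply: cvgB; last exact: cvg_cst.
  apply: cvgD; last by apply: cvgM => //; exact: cvg_cst.
  apply: cvgD => //; apply: cvgM; first exact: cvg_cst.
  by apply: cvgM.
have deltadec k : (N <= k)%N ->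
    tau1 / 8 * (a k * x k ^+ 2) + y k ^+ 2 / a k / 4 <= delta k - delta k.+1.
  by move=> /dN1; rewrite /delta (tS k) -/s; lra.
have deltaS k : (N <= k)%N -> delta k.+1 <= delta k.
  move=> /deltadec; have : 0 <= tau1 / 8 * (a k * x k ^+ 2).
    by apply: mulr_ge0; [rewrite divr_ge0// ltW | rewrite mulr_ge0 ?sqr_ge0// ltW].
  have : 0 <= y k ^+ 2 / a k / 4.
    by rewrite divr_ge0// divr_ge0 ?sqr_ge0// ltW.
  by lra.
(* A sequence that decreases from [k] on stays above its limit, which is 0. *)
have delta0 k : (N <= k)%N -> 0 <= delta k.
  move=> Nk; have [||l' cl' dl'] := @near_antitone_cvg R k delta (flb + philb - l).
  - by move=> j kj; apply: deltaS; exact: leq_trans kj.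
  - move=> j _; rewrite /delta lerD2r; have := psi_lb j.
    have := mulr_ge0 s0 (sqr_ge0 (x j)); have := mulr_ge0 c30 (t0 j); lra.
  - by rewrite (cvg_unique (@Rhausdorff R) deltac cl') dl'.
have x1 : \forall k \near \oo, x k <= 1 by exact: (cvgr_le _ xc).
have t1 : \forall k \near \oo, t k <= 1 by exact: (cvgr_le _ tc).
have [N4 _ N4x] := x1; have [N5 _ N5t] := t1.
pose N' := maxn N (maxn N3 (maxn N4 N5)).
have N'P k : (N' <= k)%N -> [/\ (N <= k)%N, (N3 <= k)%N, (N4 <= k)%N & (N5 <= k)%N].
  by rewrite !geq_max => /and4P.
pose C := 4 * (c + s `^ theta + c3 `^ theta).
have C0 : 0 < C.
  by rewrite mulr_gt0// ltr_wpDr ?powR_ge0// ltr_wpDr ?powR_ge0.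
have [|||||axB yB] := @KL_bounded_sums R N' a x y t (fun k => t k `^ theta) delta theta C (tau1 / 8)
  a_gt0 x_ge0 (fun k => enorm_ge0 _) (fun k => powR_ge0 _ _) theta01 C0.
- by rewrite divr_gt0.
- by move=> k /N'P[Nk _ _ _]; exact: delta0.
- by move=> k /N'P[Nk _ _ _]; exact: deltadec.
- move=> k /N'P[Nk N3k N4k N5k].
  apply: (KL_perturbed (p := psi k - l) th2 (ltW cp) s0 c30 _ (t0 k) (delta0 _ Nk)).
  + by rewrite x_ge0; exact: N4x.
  + exact: KL.
  + by rewrite /delta; ring.
- apply: (@bounded_sums_le R N' _ (fun k => n%:R * (alpha k * t k `^ xi))).
  + by move=> k; rewrite !mulr_ge0 ?powR_ge0// ltW.
  + move=> k /N'P[_ _ _ N5k]; rewrite /a mulrA ler_wpM2l ?(ltW (a_gt0 k))//.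
    have [->|tn0] := eqVneq (t k) 0; first by rewrite !powR0 ?gt_eqF.
    apply: ger_powR (ltW xith); rewrite lt_def tn0 t0; exact: N5t.
  + by apply: bounded_sumsZ tB; exact: ltW.
have [wl wc] := summable_steps_cvg w_bounded yB.
have [KLwl psiwl] := psi_cl wl (cvg_cluster_seq wc).
have wld : edom phi wl.
  by move: psiwl; rewrite /psi_of /edom /=; case: (phi wl) => // *; exact: ltry.
split.
- apply: (@bounded_sums_nneseries R _ (fun k => n%:R^-1 * (a k * x k))) => [k|].
    rewrite mulrA mulKf ?gt_eqF// EFinM; apply/andP; split.
      apply: mule_ge0; first by rewrite lee_fin ltW.
      by apply/ereal_infP => _ [g _ <-]; rewrite lee_fin enorm_ge0.
    by apply: lee_wpmul2l => //; rewrite lee_fin ltW.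
  by apply: bounded_sumsZ => //; rewrite invr_ge0.
- apply: (@bounded_sums_nneseries R _ y) => // k.
  by rewrite lexx lee_fin enorm_ge0.
exists wl; split=> //.
pose v k := lambda^-1 *: (z k - w k).
(* Since F_k -> 0, the weak subgradients tend to minus the limiting gradient; closedness of the
   graph then makes 0 a subgradient of [psi] at the limit. *)
have vc : v @ \oo --> - grad (favg f) wl.
  apply: enorm_cvg => e e0; have e20 : 0 < e / 2 by rewrite divr_gt0.
  have eL : 0 < e / 2 / L by rewrite divr_gt0.
  near=> k; have : x k < e / 2 by near: k; exact: (cvgr_lt _ xc).
  have : enorm (w k - wl) < e / 2 / L by near: k; exact: cvg_enorm.
  rewrite ltr_pdivlMr// => h1 h2.
  have -> : v k - - grad (favg f) wl = normal_map (favg f) lambda (z k) (w k) -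
      (grad (favg f) (w k) - grad (favg f) wl).
    by rewrite /v /normal_map; apply/rowP => j; rewrite !mxE; ring.
  apply: le_lt_trans (ler_enormD _ _) _; rewrite enormN -/(x k).
  have := h_lip _ _ (wd k) wld; lra.
have := weak_subgradient_limit phi_lsc phi_proper sg wc vc wld.
move=> /(weak_subgradient_subdiff (ltW rho_gt0) (h_diff wl)).
by rewrite subrr; exact: mem_set.
Unshelve. all: by end_near. Qed.
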